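(* Let $(X,d_X)$, $(Y,d_Y)$ be metric spaces, $(X,d_X,T)$ a local integral current space, and $\psi:X\to Y$ a map which is bi-Lipschitz on bounded subsets (that is, $\psi$ is a bijection, $\psi$ is Lipschitz on every bounded subset of $X$, and $\psi^{-1}$ is Lipschitz on every bounded subset of $Y$). Then $(Y,d_Y,\psi_\#T)$ is also a local integral current space.
   Context: Local currents (Lang–Wenger, Jauregui–Lee). An $n$-dimensional metric functional $T$ on a metric space $X$ is a real-valued multilinear functional on tuples $(f,\pi_1,\dots,\pi_n)$, where $f:X\to\mathbb R$ is bounded Lipschitz with bounded support and $\pi_i:X\to\mathbb R$ are Lipschitz on every bounded subset of $X$, such that: (locality) $T(f,\pi)=0$ if some $\pi_i$ is constant on a neighborhood of $\{f\neq0\}$; (continuity) $T(f,\pi^k)\to T(f,\pi)$ if $\pi_i^k\to\pi_i$ pointwise with Lipschitz constants uniformly bounded in $k$ on each bounded set. For open $V$, $\mathbf M_V(T)\in[0,\infty]$ is the supremum of finite sums $\sum_\lambda T(f_\lambda,\pi^\lambda)$ with $f_\lambda$ supported in $V$, $\sum_\lambda|f_\lambda|\le1$ and $\pi_i^\lambda$ $1$-Lipschitz; $\|T\|$ is the associated Borel measure. $T$ is a metric current with locally finite mass if for every bounded open $V$, $\mathbf M_V(T)<\infty$ and for every $\varepsilon>0$ there is a compact $C\subseteq V$ with $\mathbf M_{V\setminus C}(T)<\varepsilon$. The restriction of $T$ to a Borel set $B$ is $(T\llcorner B)(f,\pi)=T(f\chi_B,\pi)$ (after the standard extension to bounded Borel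 $f$ with bounded support). For $\theta\in L^1(\mathbb R^n,\mathbb Z)$, $\llbracket\theta\rrbracket(f,\pi)=\int\theta f\,d\pi_1\wedge\dots\wedge d\pi_n$. $T$ is locally integer rectifiable if it has locally finite mass, $\|T\|$ is concentrated on a countably $\mathcal H^n$-rectifiable Borel set, $\|T\|$ vanishes on $\mathcal H^n$-null Borel sets, and for every bounded Borel set $B$ and Lipschitz $\pi:X\to\mathbb R^n$, $\pi_\#(T\llcorner B)=\llbracket\theta\rrbracket$ for some $\theta\in L^1(\mathbb R^n,\mathbb Z)$. It is locally integral if in addition the boundary $\partial T$ (determined by $\partial T(f,\pi_1,\dots,\pi_{n-1})=T(\sigma,f,\pi_1,\dots,\pi_{n-1})$ for any admissible $\sigma$ equal to $1$ on a neighborhood of $\mathrm{supp} f$) is a metric current with locally finite mass. The pushforward is $\psi_\#T(f,\pi)=T(f\circ\psi,\pi_1\circ\psi,\dots,\pi_n\circ\psi)$, defined for maps that are Lipschitz on bounded sets and for which preimages of bounded sets are bounded. $\mathrm{set}_d(T)=\{p:\liminf_{r\to0}\|T\|(B_r(p))/(\omega_nr^n)>0\}$, $\omega_n$ the volume of the unit ball in $\mathbb R^n$. $(X,d,T)$ is a local integral current space if $(X,d)$ is a metric space and $T$ is an $n$-dimensional locally integral current on the completion $(\overline X,\overline d)$ with $\mathrm{set}_d(T)=X$. In the claim, $\psi_\#T$ is the pushforward under the extension $\overline X\to\overline Y$ of $\psi$ to the completions. *)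

(* Defs.v *)
From HB Require Import structures.
From mathcomp Require Import all_boot all_order all_algebra.
From mathcomp Require Import all_classical all_reals all_analysis.
From mathcomp Require Import ring.

Set Implicit Arguments.
Unset Strict Implicit.
Unset Printing Implicit Defensive.
Import Order.TTheory GRing.Theory Num.Theory.
Import numFieldNormedType.Exports.
Local Open Scope classical_set_scope.
Local Open Scope ring_scope.

(* R^n with the Euclidean distance.  ['rV[R]_n] itself carries the sup norm in
   the library, hence the alias. *)
Definition euclid (R : realType) (n : nat) : Type := 'rV[R]_n.

Section Euclid.
Variables (R : realType) (n : nat).
Implicit Types u v w : 'rV[R]_n.

HB.instance Definition _ := Choice.on (euclid R n).
HB.instance Definition _ := isPointed.Build (euclid R n) (0 : 'rV[R]_n).

Definition euclid_dist (u v : euclid R n) : R :=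
  Num.sqrt (\sum_(j < n) ((u : 'rV[R]_n) 0 j - (v : 'rV[R]_n) 0 j) ^+ 2).

Lemma euclid_distxx u : euclid_dist u u = 0.
Proof. by rewrite /euclid_dist big1 ?sqrtr0// => j _; rewrite subrr expr0n. Qed.

Lemma euclid_dist_positivity u v : euclid_dist u v = 0 -> u = v.
Proof.
move=> /eqP; rewrite sqrtr_eq0 => uv0.
have : \sum_(j < n) (u 0 j - v 0 j) ^+ 2 == 0.
  by rewrite eq_le uv0 sumr_ge0// => j _; exact: sqr_ge0.
rewrite psumr_eq0 => [/allP uv|j _]; last exact: sqr_ge0.
apply/rowP => j; apply/eqP; rewrite -subr_eq0 -sqrf_eq0.
by have := uv j; rewrite mem_index_enum => /(_ isT).
Qed.

Lemma euclid_dist_sym u v : euclid_dist u v = euclid_dist v u.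
Proof. by congr Num.sqrt; apply: eq_bigr => j _; rewrite -sqrrN opprB. Qed.

Lemma cauchy_schwarz_sum (a b : 'I_n -> R) :
  (\sum_j a j * b j) ^+ 2 <= (\sum_j a j ^+ 2) * (\sum_j b j ^+ 2).
Proof.
set A := \sum_j a j ^+ 2; set B := \sum_j b j ^+ 2; set C := \sum_j a j * b j.
have B0 : 0 <= B by apply: sumr_ge0 => j _; exact: sqr_ge0.
have : 0 <= \sum_j (B * a j - C * b j) ^+ 2.
  by apply: sumr_ge0 => j _; exact: sqr_ge0.
have -> : \sum_j (B * a j - C * b j) ^+ 2 = B * (A * B - C ^+ 2).
  transitivity (\sum_j (B ^+ 2 * (a j ^+ 2) - (B * C *+ 2) * (a j * b j)
                        + C ^+ 2 * (b j ^+ 2))).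
    by apply: eq_bigr => j _; ring.
  rewrite !big_split/= sumrN -!mulr_sumr -/A -/B -/C; ring.
move: B0; rewrite le_eqVlt => /predU1P[B0|B0]; last first.
  by rewrite pmulr_rge0// subr_ge0.
move=> _; suff -> : C = 0 by rewrite expr0n/= -B0 mulr0.
have /eqP : B = 0 by [].
rewrite psumr_eq0 => [/allP b0|j _]; last exact: sqr_ge0.
apply: big1 => j _; have := b0 j; rewrite mem_index_enum => /(_ isT).
by rewrite sqrf_eq0 => /eqP ->; rewrite mulr0.
Qed.

Lemma euclid_dist_triangle v u w :
  euclid_dist u w <= euclid_dist u v + euclid_dist v w.
Proof.
rewrite /euclid_dist.
pose a j := u 0 j - v 0 j; pose b j := v 0 j - w 0 j.
set A := \sum_j a j ^+ 2; set B := \sum_j b j ^+ 2; set C := \sum_j a j * b j.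
have A0 : 0 <= A by apply: sumr_ge0 => j _; exact: sqr_ge0.
have B0 : 0 <= B by apply: sumr_ge0 => j _; exact: sqr_ge0.
have -> : \sum_j (u 0 j - w 0 j) ^+ 2 = A + C *+ 2 + B.
  rewrite -sumrMnl -!big_split/=; apply: eq_bigr => j _.
  rewrite /a /b; ring.
have CAB : C <= Num.sqrt A * Num.sqrt B.
  rewrite -sqrtrM// (le_trans (ler_norm _))// -sqrtr_sqr ler_sqrt.
    exact: cauchy_schwarz_sum.
  exact: mulr_ge0.
rewrite -[leRHS]ger0_norm ?addr_ge0 ?sqrtr_ge0// -sqrtr_sqr ler_sqrt ?sqr_ge0//.
by rewrite sqrrD !sqr_sqrtr// lerD2r lerD2l lerMn2r.
Qed.

HB.instance Definition _ := @isMetric.Build R (euclid R n) euclid_dist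
  euclid_distxx euclid_dist_positivity euclid_dist_sym euclid_dist_triangle.

End Euclid.

Section LipschitzAndBounded.
Variable R : realType.

Definition metric_bounded (X : metricType R) (A : set X) : Prop :=
  exists M : R, forall x y, A x -> A y -> mdist x y <= M.

Definition lipschitz_in (X Y : metricType R) (L : R) (A : set X) (g : X -> Y) :=
  forall x y, A x -> A y -> mdist (g x) (g y) <= L * mdist x y.

Definition lipschitz_map (X Y : metricType R) (g : X -> Y) : Prop :=
  exists L, lipschitz_in L setT g.

Definition lipschitz_on_bounded (X Y : metricType R) (g : X -> Y) : Prop :=
  forall B : set X, metric_bounded B -> exists L, lipschitz_in L B g.

(* The inverse is given as a function: [psi] is a bijection onto [Y]. *)
Definition bilipschitz_on_bounded (X Y : metricType R) (psi : X -> Y) : Prop :=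
  lipschitz_on_bounded psi /\
  exists phi : Y -> X,
    [/\ cancel psi phi, cancel phi psi & lipschitz_on_bounded phi].

Definition spt (X : metricType R) (f : X -> R) : set X :=
  closure [set x | f x != 0].

Definition test_fun (X : metricType R) (f : X -> R) : Prop :=
  [/\ exists M : R, forall x, `|f x| <= M,
      lipschitz_map (f : X -> R^o) &
      metric_bounded (spt f)].

Definition loc_lip (X : metricType R) (p : X -> R) : Prop :=
  lipschitz_on_bounded (p : X -> R^o).

End LipschitzAndBounded.

(* Measurable types are pointed in the library; a base point, which exists
   unless the space is empty, is supplied explicitly.  The integrals below do
   not depend on its choice. *)
Definition pointed_at (X : Type) (x0 : X) : Type := X.
HB.instance Definition _ (R : realType) (X : metricType R) (x0 : X) :=
  Choice.on (pointed_at x0).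
HB.instance Definition _ (R : realType) (X : metricType R) (x0 : X) :=
  isPointed.Build (pointed_at x0) x0.

Notation borel_space X x0 :=
  (g_sigma_algebraType (@open X : set (set (pointed_at x0)))).

Section Functionals.
Variables (R : realType) (X : metricType R).

(* Functionals are total functions; only their values on tuples [(f, pi)] with
   [test_fun f] and [loc_lip (pi i)] for all [i] are meaningful. *)
Definition functional (n : nat) : Type := (X -> R) -> ('I_n -> X -> R) -> R.

Definition multilinear n (T : functional n) : Prop :=
  (forall (a : R) f g pi, test_fun f -> test_fun g -> (forall i, loc_lip (pi i)) ->
     T (fun x => a * f x + g x) pi = a * T f pi + T g pi) /\
  (forall (a : R) f pi (i : 'I_n) (u v : X -> R),
     test_fun f -> (forall j, loc_lip (pi j)) -> loc_lip u -> loc_lip v ->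
     T f (dfwith pi i (fun x => a * u x + v x)) =
       a * T f (dfwith pi i u) + T f (dfwith pi i v)).

Definition locality n (T : functional n) : Prop :=
  forall f pi, test_fun f -> (forall i, loc_lip (pi i)) ->
    (exists (i : 'I_n) (c : R),
       set_nbhs [set x | f x != 0] [set x | pi i x = c]) ->
    T f pi = 0.

Definition continuity n (T : functional n) : Prop :=
  forall f (pik : nat -> 'I_n -> X -> R) pi,
    test_fun f -> (forall k i, loc_lip (pik k i)) -> (forall i, loc_lip (pi i)) ->
    (forall i x, pik k i x @[k --> \oo] --> pi i x) ->
    (forall B : set X, metric_bounded B -> exists L : R,
       forall k i, lipschitz_in L B (pik k i : X -> R^o)) ->
    T f (pik k) @[k --> \oo] --> T f pi.

Definition metric_functional n (T : functional n) : Prop :=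
  [/\ multilinear T, locality T & continuity T].

Definition mass n (T : functional n) (V : set X) : \bar R :=
  ereal_sup [set s : \bar R | exists m (f : 'I_m -> X -> R)
                                     (pi : 'I_m -> 'I_n -> X -> R),
    [/\ forall l, test_fun (f l) /\ spt (f l) `<=` V,
        forall x, \sum_(l < m) `|f l x| <= 1,
        forall l i, lipschitz_in 1 setT (pi l i : X -> R^o) &
        s = (\sum_(l < m) T (f l) (pi l))%:E]].

(* [||T||]: the outer measure obtained from [mass T] on open sets; its
   restriction to Borel sets is a measure when T has locally finite mass. *)
Definition mass_measure n (T : functional n) (A : set X) : \bar R :=
  ereal_inf [set mass T V | V in [set V | open V /\ A `<=` V]].

Definition locally_finite_mass n (T : functional n) : Prop :=
  metric_functional T /\
  forall V : set X, open V -> metric_bounded V ->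
    (mass T V < +oo)%E /\
    forall e : R, 0 < e -> exists C : set X,
      [/\ compact C, C `<=` V & (mass T (V `\` C) < e%:E)%E].

Definition borel_set (B : set X) : Prop := <<s @open X >> B.

(* The extension of T to bounded Borel functions g with bounded support, by
   L^1(||T||)-density: |T(f, pi)| <= L ^ n \int |f| d||T|| when the pi_i are
   L-Lipschitz on the support of f, so T(f_k, pi) converges as soon as f_k -> g
   in L^1(||T||) with supports in a common bounded set, and the limit depends
   only on g and pi. *)
Definition borel_ext n (T : functional n) : functional n := fun g pi =>
  get [set v : R | exists f : nat -> X -> R,
    [/\ forall k, test_fun (f k),
        exists2 B : set X, metric_bounded B & forall k, spt (f k) `<=` B,
        forall x0 : X,
          (\int[mass_measure T : set (borel_space X x0) -> \bar R]_x
            `|f k x - g x|%:E)%E @[k --> \oo] --> 0%E &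
        T (f k) pi @[k --> \oo] --> v]].

Definition restr n (T : functional n) (B : set X) : functional n :=
  fun f pi => borel_ext T (fun x => f x * \1_B x) pi.

Definition fcons n (f : X -> R) (pi : 'I_n -> X -> R) (i : 'I_n.+1) : X -> R :=
  if unlift ord0 i is Some j then pi j else f.

Definition is_boundary n (T : functional n.+1) (S : functional n) : Prop :=
  forall f pi sigma, test_fun f -> (forall i, loc_lip (pi i)) ->
    test_fun sigma -> set_nbhs (spt f) [set x | sigma x = 1] ->
    S f pi = T sigma (fcons f pi).

(* No condition is imposed on the boundary in dimension 0. *)
Definition boundary_locally_finite_mass n : functional n -> Prop :=
  match n with
  | 0 => fun=> True
  | m.+1 => fun T => exists2 S : functional m,
              is_boundary T S & locally_finite_mass S
  end.

End Functionals.
Arguments functional {R} X n.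

Definition push_current (R : realType) (X Y : metricType R) n (psi : X -> Y)
    (T : functional X n) : functional Y n :=
  fun f pi => T (f \o psi) (fun i => pi i \o psi).

Definition pushable (R : realType) (X Y : metricType R) (psi : X -> Y) : Prop :=
  lipschitz_on_bounded psi /\
  forall B : set Y, metric_bounded B -> metric_bounded (psi @^-1` B).

Section Lebesgue.
Variable R : realType.

(* n-dimensional Lebesgue measure on Borel sets, as an iterated product of
   one-dimensional Lebesgue measures. *)
Fixpoint lebn (n : nat) : set 'rV[R]_n -> \bar R :=
  match n with
  | 0 => fun A => (\1_A 0)%:E
  | m.+1 => fun A => (\int[@lebesgue_measure R]_x
      lebn [set v : 'rV[R]_m | A (row_mx (x%:M : 'rV[R]_1) v)])%E
  end.

Definition omega (n : nat) : R :=
  fine (lebn [set v : 'rV[R]_n | @euclid_dist R n v 0 < 1]).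

Notation borelRn n := (g_sigma_algebraType (@open (euclid R n))).

Definition L1int (n : nat) (theta : euclid R n -> int) : Prop :=
  (@lebn n : set (borelRn n) -> \bar R).-integrable [set: borelRn n] (fun x => ((theta x)%:~R : R)%:E).

(* The Jacobian matrix exists almost everywhere for locally Lipschitz [pi]
   (Rademacher); ['D_v f x] is a default value elsewhere. *)
Definition jacobian_det (n : nat) (pi : 'I_n -> euclid R n -> R)
    (x : euclid R n) : R :=
  \det (\matrix_(i < n, j < n)
    ('D_(delta_mx 0 j) (pi i : 'rV[R]_n -> R) (x : 'rV[R]_n) : R)).

Definition current_of (n : nat) (theta : euclid R n -> int) :
    functional (euclid R n) n := fun f pi =>
  fine (\int[@lebn n : set (borelRn n) -> \bar R]_x
          ((theta x)%:~R * f x * jacobian_det pi x)%:E)%E.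

End Lebesgue.

Section Hausdorff.
Variables (R : realType) (X : metricType R).

Definition diam (A : set X) : \bar R :=
  ereal_sup [set (mdist p.1 p.2)%:E | p in A `*` A].

(* The empty set has weight 0 also when n = 0, where diam ^ 0 = 1. *)
Definition hausdorff_weight (n : nat) (A : set X) : \bar R :=
  if A == set0 then 0%E else ((omega R n / 2 ^+ n)%:E * diam A ^+ n)%E.

Definition hausdorff_pre (n : nat) (delta : R) (A : set X) : \bar R :=
  ereal_inf [set (\sum_(0 <= k <oo) hausdorff_weight n (C k))%E |
    C in [set C : nat -> set X | A `<=` \bigcup_k C k /\
                                 forall k, (diam (C k) <= delta%:E)%E]].

Definition hausdorff_measure (n : nat) (A : set X) : \bar R :=
  ereal_sup [set hausdorff_pre n delta A | delta in [set delta : R | 0 < delta]].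

(* The maps are defined on the subsets [A k] only, some of which may be empty;
   this also makes sense when X is empty. *)
Definition countably_rectifiable (n : nat) (E : set X) : Prop :=
  exists (A : nat -> set (euclid R n)) (phi : forall k, A k -> X),
    (forall k, exists L : R, forall u v : A k,
       mdist (phi k u) (phi k v) <= L * mdist (\val u) (\val v)) /\
    hausdorff_measure n (E `\` \bigcup_k range (phi k)) = 0%E.

End Hausdorff.

Section LocallyIntegral.
Variables (R : realType) (X : metricType R) (n : nat).

Definition locally_integer_rectifiable (T : functional X n) : Prop :=
  [/\ locally_finite_mass T,
      exists E : set X, [/\ borel_set E, countably_rectifiable n E &
                            mass_measure T (~` E) = 0%E],
      forall N : set X, borel_set N -> hausdorff_measure n N = 0%E ->
        mass_measure T N = 0%E &
      forall (B : set X) (pi : X -> euclid R n),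
        borel_set B -> metric_bounded B -> lipschitz_map pi ->
        exists2 theta : euclid R n -> int, L1int theta &
          forall f tau, test_fun f -> (forall i, loc_lip (tau i)) ->
            push_current pi (restr T B) f tau = current_of theta f tau].

Definition locally_integral (T : functional X n) : Prop :=
  locally_integer_rectifiable T /\ boundary_locally_finite_mass T.

Definition set_d (T : functional X n) : set X :=
  [set p | (0 < limf_einf (fun r : R =>
      mass_measure T (ball p r) * ((omega R n * r ^+ n)^-1)%:E) (0 : R)^'+)%E].

End LocallyIntegral.

(* A completion of X; unique up to a unique isometry over X.  Completeness is
   that of the library's [completeType], which would exclude the empty space. *)
Record completion (R : realType) (X : metricType R) := Completion {
  completion_space :> metricType R ;
  embed : X -> completion_space ;
  embed_isometry : forall x y, mdist (embed x) (embed y) = mdist x y ;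
  embed_dense : dense (range embed) ;
  completion_complete : forall F : set_system completion_space,
    ProperFilter F -> cauchy F -> exists l : completion_space, F --> l
}.

Definition local_integral_current_space (R : realType) (n : nat)
    (X : metricType R) (Xb : completion X) (T : functional Xb n) : Prop :=
  locally_integral T /\ set_d T = range (@embed R X Xb).

(* Main.v *)
(* A bi-Lipschitz map psi extends to the completions as a bijection psib whose
   inverse phib is of the same kind. Every requirement on psib_# T is local up to
   countable decompositions, and on a bounded open set V on which psib has
   Lipschitz constant L the coordinates pi o psib agree with L times a
   1-Lipschitz function, so locality and multilinearity give
   M_V(psib_# T) <= L^n M_(psib^-1 V)(T). Hence the two mass measures are
   comparable on bounded sets, which transports tightness, the lower density
   condition, L^1-convergence (thus the extension to Borel functions) and, by
   cutting into bounded shells, null sets. As T = phib_# (psib_# T), each of these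
   comparisons is two-sided. For the integer multiplicities, pi o psib is only
   Lipschitz near the bounded Borel set under consideration and is replaced by a
   global Lipschitz extension of its restriction. *)
From HB Require Import structures.
Require Import Defs.
From mathcomp Require Import all_boot all_order all_algebra.
From mathcomp Require Import all_classical all_reals all_analysis.
From mathcomp Require Import ring lra zify.
Set Implicit Arguments.
Unset Strict Implicit.
Unset Printing Implicit Defensive.
Import Order.TTheory GRing.Theory Num.Theory.
Import numFieldNormedType.Exports.
Local Open Scope classical_set_scope.
Local Open Scope ring_scope.

(** * Lipschitz maps and test functions *)

(** [mass_measure T] is an infimum of masses of open sets and is integrated as a bare set function,
    so the usual measure estimates are rebuilt from open sets and Lipschitz cut-offs. The piecewise
    linear functions [hat k] serve twice. Composed with the distance to a base point, they cut a
    current into bounded shells, each with its own Lipschitz constant. Composed with [h / e], they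
    cut a test function [h] by height, which gives the bound of |T(h, sigma)| by \int |h| d||T||
    with the crude factor 32 L ^ n. This bound is needed for the integer multiplicities. Locality
    only sees test functions, and those approximating [f * \1_B] may have supports far larger than
    B; the bound shows that multiplying them by a cut-off equal to 1 on B does not change the limit,
    after which the coordinates may be altered away from B. Since [borel_ext] picks one limit with
    [get], equality of two extensions is obtained from equality of their sets of limits. *)

Section MetricBasics.
Variable R : realType.
Implicit Types X Y Z : metricType R.

Lemma open_mdistP X (U : set X) : open U <->
  forall x, U x -> exists2 e : R, 0 < e & forall y, mdist x y < e -> U y.
Proof.
rewrite openE; split=> HU x Ux; have := HU x Ux.
  move=> /nbhs_ballP[e /= e0 eU]; exists e => // y xy; apply: eU.
  by rewrite ballEmdist.
move=> [e e0 eU]; apply/nbhs_ballP; exists e => //= y; rewrite ballEmdist.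
exact: eU.
Qed.

Lemma mdist_dist_le X (x y z : X) : `|mdist z y - mdist z x| <= mdist x y.
Proof.
rewrite ler_norml lerBlDr lerBrDr.
have := metric_triangle z y x; have := metric_triangle z x y.
by rewrite (metric_sym y x); lra.
Qed.

Lemma metric_bounded_sub X (A B : set X) :
  A `<=` B -> metric_bounded B -> metric_bounded A.
Proof. by move=> AB [M HM]; exists M => x y /AB ? /AB; exact: HM. Qed.

Lemma metric_bounded_mdist_lt X (x : X) (r : R) :
  metric_bounded [set y | mdist x y < r].
Proof.
exists (r + r) => y z /= xy xz; have := metric_triangle y x z.
by rewrite (metric_sym y x); lra.
Qed.

Lemma metric_boundedP X (x0 : X) (A : set X) : metric_bounded A ->
  exists2 r : R, 0 < r & A `<=` [set y | mdist x0 y < r].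
Proof.
move=> [M HM]; have [->|/set0P[a Aa]] := eqVneq A set0; first by exists 1.
have := mdist_ge0 x0 a; have := HM a a Aa Aa; rewrite mdistxx => M0 d0.
exists (mdist x0 a + M + 1); first by lra.
move=> y /= Ay; have := metric_triangle x0 a y; have := HM a y Aa Ay; lra.
Qed.

Lemma metric_boundedU X (A B : set X) :
  metric_bounded A -> metric_bounded B -> metric_bounded (A `|` B).
Proof.
move=> Ab Bb; have [->|/set0P[x0 _]] := eqVneq A set0; first by rewrite set0U.
have [r r0 Ar] := metric_boundedP x0 Ab; have [s s0 Bs] := metric_boundedP x0 Bb.
apply: metric_bounded_sub (@metric_bounded_mdist_lt _ x0 (r + s)).
by move=> y [/Ar|/Bs]/=; lra.
Qed.

(** Lipschitz constants exist only on bounded sets, whereas mass and locality speak of open sets.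
    The margin 1 gives room to move off A while keeping one constant. *)
Lemma metric_bounded_nbhd X (A : set X) : metric_bounded A ->
  exists N : set X, [/\ open N, metric_bounded N &
    forall x y, A x -> mdist x y < 1 -> N y].
Proof.
move=> [M AM]; exists (\bigcup_(a in A) [set y | mdist a y < 1]); split.
- apply: bigcup_open => a _; apply/open_mdistP => x /= ax.
  exists (1 - mdist a x); first by lra.
  by move=> y xy; have := metric_triangle a x y; lra.
- exists (M + 2) => x y [a /AM Aa /= ax] [b /Aa ab /= yb].
  have := metric_triangle x a y; have := metric_triangle a b y.
  by rewrite (metric_sym x a); lra.
- by move=> x y Ax xy; exists x.
Qed.

Lemma lipschitz_in_sub X Y L L' (A B : set X) (g : X -> Y) :
  A `<=` B -> L <= L' -> lipschitz_in L B g -> lipschitz_in L' A g.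
Proof.
move=> AB LL gL x y /AB Bx /AB By; apply: le_trans (gL _ _ Bx By) _.
by rewrite ler_wpM2r ?mdist_ge0.
Qed.

Lemma lipschitz_on_bounded_ge1 X Y (g : X -> Y) (B : set X) :
  lipschitz_on_bounded g -> metric_bounded B ->
  exists2 L, 1 <= L & lipschitz_in L B g.
Proof.
move=> gl /gl[L gL]; exists (Num.max L 1); first by rewrite le_max lexx orbT.
by apply: lipschitz_in_sub gL => //; rewrite le_max lexx.
Qed.

Lemma lipschitz_on_bounded_continuous X Y (g : X -> Y) :
  lipschitz_on_bounded g -> continuous g.
Proof.
move=> gl x; apply/cvg_ballP => e e0.
have [L L1 gL] := lipschitz_on_bounded_ge1 gl (metric_bounded_mdist_lt x 1).
apply/nbhs_ballP; exists (Num.min 1 (e / L)) => /=.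
  by rewrite lt_min ltr01 divr_gt0//; lra.
move=> y; rewrite !ballEmdist/= lt_min => /andP[xy1].
rewrite ltr_pdivlMr; last lra.
rewrite mulrC; apply: le_lt_trans; apply: gL => //=; rewrite mdistxx; lra.
Qed.

Lemma lipschitz_on_bounded_image X Y (g : X -> Y) (B : set X) :
  lipschitz_on_bounded g -> metric_bounded B -> metric_bounded (g @` B).
Proof.
move=> gl Bb; have [L L1 gL] := lipschitz_on_bounded_ge1 gl Bb.
have [M HM] := Bb; exists (L * M) => _ _ [x Bx <-] [y By <-].
by apply: le_trans (gL _ _ Bx By) _; rewrite ler_wpM2l//; [lra|exact: HM].
Qed.

Lemma lipschitz_on_bounded_preimage X Y (g : X -> Y) (h : Y -> X) (B : set Y) :
  cancel g h -> lipschitz_on_bounded h -> metric_bounded B ->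
  metric_bounded (g @^-1` B).
Proof.
move=> gK hl /(lipschitz_on_bounded_image hl); apply: metric_bounded_sub.
by move=> x /= Bx; exists (g x).
Qed.

Lemma lipschitz_on_bounded_comp X Y Z (g : X -> Y) (h : Y -> Z) :
  lipschitz_on_bounded g -> lipschitz_on_bounded h ->
  lipschitz_on_bounded (h \o g).
Proof.
move=> gl hl B Bb; have [L L1 gL] := lipschitz_on_bounded_ge1 gl Bb.
have [K K1 hK] := lipschitz_on_bounded_ge1 hl (lipschitz_on_bounded_image gl Bb).
exists (K * L) => x y Bx By.
apply: le_trans (hK _ _ (imageP g Bx) (imageP g By)) _.
by rewrite -mulrA ler_wpM2l//; [lra|exact: gL].
Qed.

Lemma lipschitz_map_on_bounded X Y (g : X -> Y) :
  lipschitz_map g -> lipschitz_on_bounded g.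
Proof. by move=> [L gL] B _; exists L; apply: lipschitz_in_sub gL. Qed.

Lemma lipschitz_inRP X (L : R) (A : set X) (g : X -> R) :
  (forall x y, A x -> A y -> `|g x - g y| <= L * mdist x y) ->
  lipschitz_in L A (g : X -> R^o).
Proof. by move=> gL x y Ax Ay; rewrite /mdist/= distrC; exact: gL. Qed.

Lemma lipschitz_inR X (L : R) (A : set X) (g : X -> R) :
  lipschitz_in L A (g : X -> R^o) ->
  forall x y, A x -> A y -> `|g x - g y| <= L * mdist x y.
Proof. by move=> gL x y Ax Ay; rewrite distrC; exact: gL. Qed.

End MetricBasics.

Section LocLip.
Variables (R : realType) (X : metricType R).
Implicit Types (f g h u v : X -> R).

Lemma loc_lip_continuous f : loc_lip f -> continuous f.
Proof. by move=> fl; exact: (@lipschitz_on_bounded_continuous R X R^o f fl). Qed.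

Lemma loc_lip_bounded f (B : set X) : loc_lip f -> metric_bounded B ->
  exists2 M : R, 0 <= M & forall x, B x -> `|f x| <= M.
Proof.
move=> fl Bb; have [L L1 fL] := lipschitz_on_bounded_ge1 fl Bb.
have [->|/set0P[b Bb']] := eqVneq B set0; first by exists 0.
have [M HM] := Bb.
have M0 : 0 <= M by have := HM _ _ Bb' Bb'; rewrite mdistxx.
exists (`|f b| + L * M); first by rewrite addr_ge0// mulr_ge0//; lra.
move=> x Bx; have := lipschitz_inR fL Bx Bb'.
have : L * mdist x b <= L * M by rewrite ler_wpM2l ?HM//; lra.
have := ler_normD (f x - f b) (f b); rewrite subrK; lra.
Qed.

Lemma loc_lip_cst (c : R) : loc_lip (fun _ : X => c).
Proof.
move=> B _; exists 0; apply: lipschitz_inRP => x y _ _.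
by rewrite subrr normr0 mul0r.
Qed.

Lemma loc_lip_lin (a : R) u v : loc_lip u -> loc_lip v ->
  loc_lip (fun x => a * u x + v x).
Proof.
move=> ul vl B Bb; have [L L1 uL] := lipschitz_on_bounded_ge1 ul Bb.
have [K K1 vK] := lipschitz_on_bounded_ge1 vl Bb.
exists (`|a| * L + K); apply: lipschitz_inRP => x y Bx By.
have -> : a * u x + v x - (a * u y + v y) = a * (u x - u y) + (v x - v y) by ring.
apply: le_trans (ler_normD _ _) _; rewrite normrM mulrDl lerD//.
  by rewrite -mulrA ler_wpM2l//; exact: lipschitz_inR uL _ _ Bx By.
exact: lipschitz_inR vK _ _ Bx By.
Qed.

Lemma loc_lipB u v : loc_lip u -> loc_lip v -> loc_lip (fun x => u x - v x).
Proof.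
move=> ul vl; rewrite (_ : (fun _ => _) = (fun x => -1 * v x + u x)).
  exact: loc_lip_lin.
by apply/funext => x; rewrite mulN1r addrC.
Qed.

Lemma loc_lipM u v : loc_lip u -> loc_lip v -> loc_lip (fun x => u x * v x).
Proof.
move=> ul vl B Bb; have [L L1 uL] := lipschitz_on_bounded_ge1 ul Bb.
have [K K1 vK] := lipschitz_on_bounded_ge1 vl Bb.
have [M M0 uM] := loc_lip_bounded ul Bb.
have [N N0 vN] := loc_lip_bounded vl Bb.
exists (M * K + L * N); apply: lipschitz_inRP => x y Bx By.
have -> : u x * v x - u y * v y = u x * (v x - v y) + (u x - u y) * v y by ring.
apply: le_trans (ler_normD _ _) _; rewrite !normrM mulrDl lerD//.
  by rewrite -mulrA ler_pM// ?uM//; exact: lipschitz_inR vK _ _ Bx By.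
by rewrite mulrAC ler_pM// ?vN//; exact: lipschitz_inR uL _ _ Bx By.
Qed.

Lemma loc_lip_compR (K : R) (theta : R -> R) u : loc_lip u ->
  (forall s t, `|theta s - theta t| <= K * `|s - t|) ->
  loc_lip (fun x => theta (u x)).
Proof.
move=> ul thetaK B Bb; have [L L1 uL] := lipschitz_on_bounded_ge1 ul Bb.
exists (Num.max K 0 * L); apply: lipschitz_inRP => x y Bx By.
apply: le_trans (thetaK _ _) _; rewrite -mulrA.
apply: (@le_trans _ _ (Num.max K 0 * `|u x - u y|)).
  by rewrite ler_wpM2r// le_max lexx.
by rewrite ler_wpM2l ?le_max ?lexx ?orbT//; exact: lipschitz_inR uL _ _ Bx By.
Qed.

Lemma loc_lip_mdist (x0 : X) : loc_lip (mdist x0).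
Proof.
move=> B _; exists 1; apply: lipschitz_inRP => x y _ _.
by rewrite mul1r -[leRHS](metric_sym y x); exact: mdist_dist_le.
Qed.

Lemma loc_lip_comp (Y : metricType R) (psi : X -> Y) (p : Y -> R) :
  lipschitz_on_bounded psi -> loc_lip p -> loc_lip (p \o psi).
Proof. exact: lipschitz_on_bounded_comp. Qed.

Lemma spt_sub f (F : set X) : closed F -> [set x | f x != 0] `<=` F ->
  spt f `<=` F.
Proof. by move=> cF fF; rewrite /spt closureE => x; apply; split. Qed.

Lemma sub_spt f x : f x != 0 -> spt f x.
Proof. by move=> fx; exact: subset_closure. Qed.

Lemma spt_le f g : (forall x, f x != 0 -> g x != 0) -> spt f `<=` spt g.
Proof. by move=> fg; apply: closure_subset => x; exact: fg. Qed.

(** Local Lipschitz bounds suffice. Let x be in the support. If y is within distance 1, or also in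
    the support, both points lie in the bounded set [N]; otherwise f y = 0 and |f x| <= M <= M *
    mdist x y. Products and compositions are then handled by [loc_lip] alone. *)
Lemma test_funP f : test_fun f <->
  [/\ exists M : R, forall x, `|f x| <= M, loc_lip f & metric_bounded (spt f)].
Proof.
split=> [[fM fl fb]|[[M fM] fl fb]]; split=> //.
- exact: lipschitz_map_on_bounded.
- by exists M.
have [N [_ Nb fN]] := metric_bounded_nbhd fb.
have sN : spt f `<=` N by move=> x fx; apply: fN fx _; rewrite mdistxx ltr01.
have [L L1 fL] := lipschitz_on_bounded_ge1 fl Nb.
exists (Num.max L M).
have key x y : spt f x -> `|f x - f y| <= Num.max L M * mdist x y.
  move=> fx; have [xy|xy] := ltP (mdist x y) 1.
    have := lipschitz_inR fL (sN _ fx) (fN _ _ fx xy).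
    move=> /le_trans; apply; rewrite ler_wpM2r ?mdist_ge0//.
    by rewrite le_max lexx.
  have [fy|/eqP fy] := boolP (f y == 0).
    rewrite (eqP fy) subr0; apply: le_trans (fM x) _.
    rewrite -[leLHS]mulr1 ler_pM//; first exact: le_trans (fM x).
    by rewrite le_max lexx orbT.
  have := lipschitz_inR fL (sN _ fx) (sN _ (sub_spt (introN eqP fy))).
  move=> /le_trans; apply; rewrite ler_wpM2r ?mdist_ge0//.
  by rewrite le_max lexx.
apply: lipschitz_inRP => x y _ _.
have [fx|fx] := boolP (f x == 0); last exact/key/sub_spt.
have [fy|fy] := boolP (f y == 0).
  rewrite (eqP fx) (eqP fy) subrr normr0 mulr_ge0 ?mdist_ge0// le_max.
  by apply/orP; left; lra.
by rewrite distrC metric_sym; exact/key/sub_spt.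
Qed.

Lemma test_fun_loc_lip f : test_fun f -> loc_lip f.
Proof. by case/test_funP. Qed.

Lemma test_fun0 : test_fun (fun _ : X => 0 : R).
Proof.
apply/test_funP; split; [by exists 0 => x; rewrite normr0|exact: loc_lip_cst|].
by exists 0 => x y; rewrite /spt (_ : [set _ | _] = set0) ?closure0//;
  apply/seteqP; split => // z /=; rewrite eqxx.
Qed.

Lemma test_fun_lin (a : R) f g : test_fun f -> test_fun g ->
  test_fun (fun x => a * f x + g x).
Proof.
move=> /test_funP[[M fM] fl fb] /test_funP[[N gN] gl gb]; apply/test_funP; split.
- exists (`|a| * M + N) => x; apply: le_trans (ler_normD _ _) _.
  by rewrite normrM lerD// ler_wpM2l.
- exact: loc_lip_lin.
- have sub : spt (fun x => a * f x + g x) `<=` spt f `|` spt g.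
    apply: spt_sub; first by apply: closedU; exact: closed_closure.
    move=> x /= afg; have [fx|fx] := eqVneq (f x) 0; last by left; exact: sub_spt.
    by right; apply: sub_spt; move: afg; rewrite fx mulr0 add0r.
  by apply: metric_bounded_sub sub _; exact: metric_boundedU.
Qed.

Lemma test_fun_le f u : test_fun f -> loc_lip u ->
  (forall x, `|u x| <= `|f x|) -> test_fun u.
Proof.
move=> /test_funP[[M fM] fl fb] ul uf; apply/test_funP; split => //.
  by exists M => x; exact: le_trans (uf x) (fM x).
apply: metric_bounded_sub fb; apply: spt_le => x; apply: contra => /eqP fx.
by have := uf x; rewrite fx normr0 normr_le0.
Qed.

Lemma test_funM f u : test_fun f -> loc_lip u -> test_fun (fun x => f x * u x).
Proof.
move=> /test_funP[[M fM] fl fb] ul; apply/test_funP; split.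
- have [K K0 uK] := loc_lip_bounded ul fb.
  exists (M * K) => x; rewrite normrM.
  have M0 : 0 <= M by exact: le_trans (fM x).
  have [->|fx] := eqVneq (f x) 0; first by rewrite normr0 mul0r mulr_ge0.
  by rewrite ler_pM// uK//; exact: sub_spt.
- exact: loc_lipM.
- apply: metric_bounded_sub fb; apply: spt_le => x; apply: contra => /eqP ->.
  by rewrite mul0r.
Qed.

Lemma spt_mul f u : spt (fun x => f x * u x) `<=` spt f.
Proof. by apply: spt_le => x; apply: contra => /eqP ->; rewrite mul0r. Qed.

Lemma spt_mulr f u : spt (fun x => f x * u x) `<=` spt u.
Proof. by apply: spt_le => x; apply: contra => /eqP ->; rewrite mulr0. Qed.

End LocLip.

Section TestFunComp.
Variables (R : realType) (X Y : metricType R) (psi : X -> Y) (phi : Y -> X).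
Hypotheses (psiK : cancel psi phi).
Hypotheses (psi_lip : lipschitz_on_bounded psi) (phi_lip : lipschitz_on_bounded phi).

Lemma spt_comp (f : Y -> R) : spt (f \o psi) `<=` psi @^-1` spt f.
Proof.
apply: spt_sub => [|x /= fx]; last exact: sub_spt.
apply: preimage_closed; last exact: closed_closure.
by move=> x _; exact: lipschitz_on_bounded_continuous.
Qed.

Lemma test_fun_comp (f : Y -> R) : test_fun f -> test_fun (f \o psi).
Proof.
move=> /test_funP[[M fM] fl fb]; apply/test_funP; split.
- by exists M => x; exact: fM.
- exact: loc_lip_comp.
- apply: metric_bounded_sub (@spt_comp f) _.
  exact: lipschitz_on_bounded_preimage psiK phi_lip fb.
Qed.

End TestFunComp.

(** * Metric functionals and their mass *)

Section MetricFunctional.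
Variables (R : realType) (X : metricType R) (n : nat) (T : functional X n).

(** The coordinates are exchanged one at a time through the hybrid tuples [H k], equal to p below
    index k and to q from k on; each exchange costs a factor c. *)
Lemma functional_swap (c : R) (f : X -> R) (p q : 'I_n -> X -> R) :
  (forall i, loc_lip (p i)) -> (forall i, loc_lip (q i)) ->
  (forall pi i, (forall j, loc_lip (pi j)) ->
     T f (dfwith pi i (p i)) = c * T f (dfwith pi i (q i))) ->
  T f p = c ^+ n * T f q.
Proof.
move=> pl ql step; pose H k := fun i : 'I_n => if (i < k)%N then p i else q i.
have Hl k i : loc_lip (H k i) by rewrite /H; case: ifP.
suff main k : (k <= n)%N -> T f (H k) = c ^+ k * T f q.
  rewrite -main//; congr (T f _); apply/funext => i.
  by rewrite /H ltn_ord.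
elim: k => [_|k IH kn]; first by rewrite expr0 mul1r; congr T; exact/funext.
have -> : H k.+1 = dfwith (H k) (Ordinal kn) (p (Ordinal kn)).
  apply/funext => i; case: dfwithP => [|j kj]; first by rewrite /H /= ltnSn.
  have {}kj : (j : nat) != k by move: kj; rewrite eq_sym.
  by rewrite /H ltnS leq_eqVlt (negbTE kj).
rewrite step// exprS -mulrA -(IH (ltnW kn)); congr (_ * T f _).
by apply/funext => i; case: dfwithP => [|j kj]//; rewrite /H /= ltnn.
Qed.

Hypothesis Tmf : metric_functional T.

Lemma functionalD f g pi : test_fun f -> test_fun g -> (forall i, loc_lip (pi i)) ->
  T (fun x => f x + g x) pi = T f pi + T g pi.
Proof.
have [[Tlin _] _ _] := Tmf; move=> tf tg pl; have := Tlin 1 f g pi tf tg pl.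
by under eq_fun do rewrite mul1r; rewrite mul1r.
Qed.

Lemma functional0 pi : (forall i, loc_lip (pi i)) -> T (fun=> 0) pi = 0.
Proof.
move=> pl; have t0 := test_fun0 X.
have := functionalD t0 t0 pl; under eq_fun do rewrite addr0.
by move=> /esym/eqP; rewrite -subr_eq0 addrK => /eqP.
Qed.

Lemma functionalZ (a : R) f pi : test_fun f -> (forall i, loc_lip (pi i)) ->
  T (fun x => a * f x) pi = a * T f pi.
Proof.
have [[Tlin _] _ _] := Tmf; move=> tf pl.
have := Tlin a f (fun=> 0) pi tf (test_fun0 X) pl.
by under eq_fun do rewrite addr0; rewrite functional0// addr0.
Qed.

Lemma test_fun_sum m (f : nat -> X -> R) : (forall k, test_fun (f k)) ->
  test_fun (fun x => \sum_(k < m) f k x).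
Proof.
move=> tf; elim: m => [|m IH].
  by under eq_fun do rewrite big_ord0; exact: test_fun0.
under eq_fun do rewrite big_ord_recr /= -[X in X + _]mul1r.
exact: test_fun_lin.
Qed.

Lemma functional_sum m (f : nat -> X -> R) pi : (forall k, test_fun (f k)) ->
  (forall i, loc_lip (pi i)) ->
  T (fun x => \sum_(k < m) f k x) pi = \sum_(k < m) T (f k) pi.
Proof.
move=> tf pl; elim: m => [|m IH].
  by rewrite big_ord0; under eq_fun do rewrite big_ord0; exact: functional0.
rewrite big_ord_recr /= -IH -functionalD//; last exact: test_fun_sum.
by congr T; apply/funext => x; rewrite big_ord_recr.
Qed.

(** In each slot, p i - q i vanishes on U, a neighbourhood of the set where f is nonzero; linearity
    in the slot and locality then allow the exchange. *)
Lemma functional_eq_on f p q (U : set X) : test_fun f -> open U ->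
  [set x | f x != 0] `<=` U -> (forall i, loc_lip (p i)) ->
  (forall i, loc_lip (q i)) -> (forall i x, U x -> p i x = q i x) ->
  T f p = T f q.
Proof.
move=> tf oU fU pl ql pq; rewrite -[RHS]mul1r -(expr1n _ n).
apply: functional_swap => // pi i pil; rewrite mul1r.
have [[_ Tlin] Tloc _] := Tmf; have := Tlin (-1) f pi i (q i) (p i) tf pil (ql i) (pl i).
rewrite Tloc//.
- by rewrite mulN1r => /eqP; rewrite eq_sym addrC subr_eq0 => /eqP.
- move=> j; case: dfwithP => //; exact: loc_lip_lin.
- exists i, 0; apply/set_nbhsP; exists U; split => // x Ux /=.
  by rewrite dfwithin pq// mulN1r addNr.
Qed.

Lemma functional_scale (c : R) f p : test_fun f -> (forall i, loc_lip (p i)) ->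
  T f (fun i x => c * p i x) = c ^+ n * T f p.
Proof.
move=> tf pl.
have pcl u : loc_lip u -> loc_lip (fun x : X => c * u x).
  by move=> ul; exact: (loc_lipM (@loc_lip_cst R X c) ul).
apply: functional_swap => //; first by move=> i; exact: pcl.
move=> pi i pil; have [[_ Tlin] Tloc _] := Tmf.
(* Linearity is available in the form c * u + v; homogeneity is the case v = 0, where the extra term
   vanishes by locality. *)
have c0 := @loc_lip_cst R X 0.
have := Tlin c f pi i (p i) (fun=> 0) tf pil (pl i) c0.
have -> : (fun x => c * p i x + 0) = (fun x => c * p i x).
  by apply/funext => x; rewrite addr0.
rewrite (Tloc f (dfwith pi i (fun=> 0))) ?addr0//.
- by move=> j; case: dfwithP.
- exists i, 0; apply/set_nbhsP; exists setT; split => //; first exact: openT.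
  by move=> x _ /=; rewrite dfwithin.
Qed.

End MetricFunctional.

(** McShane's formula: h x is the infimum over y in A of g y + L * mdist x y. The empty A is treated
    apart, since the infimum is then meaningless. *)
Lemma mcshane_extension (R : realType) (X : metricType R) (A : set X) (L : R)
    (g : X -> R) : 0 <= L -> lipschitz_in L A (g : X -> R^o) ->
  exists h : X -> R, [/\ lipschitz_in L setT (h : X -> R^o) &
                         forall x, A x -> h x = g x].
Proof.
move=> L0 gL; have [->|/set0P[a Aa]] := eqVneq A set0.
  exists (fun=> 0); split=> //; apply: lipschitz_inRP => x y _ _.
  by rewrite subrr normr0 mulr_ge0 ?mdist_ge0.
pose S x := [set g y + L * mdist x y | y in A].
have Sne x : S x !=set0 by exists (g a + L * mdist x a); exists a.
have Slb x : lbound (S x) (g a - L * mdist x a).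
  move=> _ [y Ay <-]; have := lipschitz_inR gL Aa Ay.
  have : L * mdist a y <= L * (mdist x a + mdist x y).
    by rewrite ler_wpM2l// (metric_sym x a) metric_triangle.
  have := ler_norm (g a - g y); rewrite mulrDr; lra.
have hlb x : has_lbound (S x) by exists (g a - L * mdist x a).
have half x y : inf (S x) <= inf (S y) + L * mdist x y.
  rewrite -lerBlDr; apply: lb_le_inf => // _ [z Az <-]; rewrite lerBlDr.
  apply: (@le_trans _ _ (g z + L * mdist x z)); first by apply: ge_inf => //; exists z.
  by rewrite -addrA lerD2l -mulrDr ler_wpM2l// addrC metric_triangle.
exists (fun x => inf (S x)); split.
  apply: lipschitz_inRP => x y _ _; rewrite ler_norml.
  have := half x y; have := half y x; rewrite (metric_sym y x); lra.
move=> x Ax; apply/eqP; rewrite eq_le; apply/andP; split.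
  by apply: ge_inf => //; exists x => //; rewrite mdistxx mulr0 addr0.
apply: lb_le_inf => // _ [y Ay <-]; have := lipschitz_inR gL Ax Ay.
have := ler_norm (g x - g y); lra.
Qed.

(** Mass tests only 1-Lipschitz coordinates. The tuple q is the McShane extension of the restriction
    of p to V, divided by L; it is chosen before f, so one q serves all test functions supported in
    V. *)
Lemma functional_lipschitz1 (R : realType) (X : metricType R) n
    (T : functional X n) (V : set X) (L : R) (p : 'I_n -> X -> R) :
  metric_functional T -> open V -> 0 < L -> (forall i, loc_lip (p i)) ->
  (forall i, lipschitz_in L V (p i : X -> R^o)) ->
  exists q : 'I_n -> X -> R, (forall i, lipschitz_in 1 setT (q i : X -> R^o)) /\
    forall f, test_fun f -> spt f `<=` V -> T f p = L ^+ n * T f q.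
Proof.
move=> Tmf oV L0 pl pL.
have ext i : exists q : X -> R, lipschitz_in 1 setT (q : X -> R^o) /\
    forall x, V x -> L * q x = p i x.
  have [h [hL hpi]] := mcshane_extension (ltW L0) (pL i).
  exists (fun x => h x / L); split=> [|x Vx]; last first.
    by rewrite mulrC divfK ?gt_eqF// hpi.
  apply: lipschitz_inRP => x y _ _.
  rewrite -mulrBl normrM normfV (gtr0_norm L0) ler_pdivrMr// mul1r mulrC.
  exact: (lipschitz_inR hL (x := x) (y := y) I I).
have [q /all_and2[q1 qp]] := choice ext; exists q; split => // f tf fV.
have ql i : loc_lip (q i) by apply: lipschitz_map_on_bounded; exists 1; exact: q1.
rewrite -functional_scale//; apply: (functional_eq_on Tmf (U := V)) => //.
- by move=> x fx; exact/fV/sub_spt.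
- by move=> i; exact: (loc_lipM (@loc_lip_cst R X L) (ql i)).
- by move=> i x Vx; rewrite qp.
Qed.

Section Mass.
Variables (R : realType) (X : metricType R) (n : nat) (T : functional X n).
Implicit Types (V U A : set X).
Local Open Scope ereal_scope.

Lemma mass_ge V m (f : 'I_m -> X -> R) (pi : 'I_m -> 'I_n -> X -> R) :
  (forall l, test_fun (f l)) -> (forall l, spt (f l) `<=` V) ->
  (forall x, (\sum_(l < m) `|f l x| <= 1)%R) ->
  (forall l i, lipschitz_in 1 setT (pi l i : X -> R^o)) ->
  (\sum_(l < m) T (f l) (pi l))%:E <= mass T V.
Proof.
by move=> tf fV f1 pi1; apply: ereal_sup_ubound; exists m, f, pi; split => // l.
Qed.

Lemma mass_ge0 V : 0 <= mass T V.
Proof.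
have -> : 0 = (\sum_(l < 0) T (fun=> 0%R) (fun _ => fun=> 0%R))%:E by rewrite big_ord0.
by apply: mass_ge => [[]|[]|x|[]]//; rewrite big_ord0.
Qed.

Lemma mass_sub V U : V `<=` U -> mass T V <= mass T U.
Proof.
move=> VU; apply: ge_ereal_sup => _ [m [f [pi [fV f1 pi1 ->]]]].
apply: mass_ge => // l; first by case: (fV l).
by have [_ fVl] := fV l; exact: subset_trans VU.
Qed.

Lemma mass_measure_ge0 A : 0 <= mass_measure T A.
Proof. by apply: le_ereal_inf_tmp => _ [V _ <-]; exact: mass_ge0. Qed.

Lemma mass_measure_sub A U : A `<=` U -> mass_measure T A <= mass_measure T U.
Proof.
move=> AU; apply: ereal_inf_le_tmp => _ [V [oV UV] <-]; exists V => //; split => //.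
exact: subset_trans UV.
Qed.

Lemma mass_measure_le A V : open V -> A `<=` V -> mass_measure T A <= mass T V.
Proof. by move=> oV AV; apply: ereal_inf_lbound; exists V. Qed.

Lemma mass_le_measure V : mass T V <= mass_measure T V.
Proof. by apply: le_ereal_inf_tmp => _ [U [_ VU] <-]; exact: mass_sub. Qed.

Hypothesis Tmf : metric_functional T.

Lemma mass_bound V (e : R) f (pi : 'I_n -> X -> R) : (0 < e)%R -> test_fun f ->
  spt f `<=` V -> (forall x, `|f x| <= e)%R ->
  (forall i, lipschitz_in 1 setT (pi i : X -> R^o)) ->
  `|T f pi|%:E <= e%:E * mass T V.
Proof.
move=> e0 tf fV fe pi1.
have pil i : loc_lip (pi i) by apply: lipschitz_map_on_bounded; exists 1%R; exact: pi1.
(* The one-element family [s / e * f] competes in the supremum; s is the sign of [T f pi]. *)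
have key (s : R) : (`|s| = 1)%R -> (s * T f pi)%:E <= e%:E * mass T V.
  move=> s1; rewrite muleC -lee_pdivrMr// -EFinM.
  rewrite (_ : _ * _ / _ = T (fun x => s / e * f x) pi)%R; last first.
    by rewrite functionalZ// mulrAC.
  have := @mass_ge V 1 (fun _ x => s / e * f x)%R (fun=> pi).
  rewrite big_ord1; apply => //.
  - move=> _; have := test_fun_lin (s / e) tf (test_fun0 X).
    by under eq_fun do rewrite addr0.
  - move=> _; apply: subset_trans fV; apply: spt_le => x.
    by apply: contra => /eqP ->; rewrite mulr0.
  - move=> x; rewrite big_ord1 normrM normf_div s1 (gtr0_norm e0) mul1r mulrC.
    by rewrite ler_pdivrMr// mul1r.
have [h|h] := leP 0%R (T f pi).
  by rewrite ger0_norm//; have := key 1%R; rewrite normr1 mul1r; exact.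
by rewrite ltr0_norm//; have := key (-1)%R; rewrite normrN1 mulN1r; exact.
Qed.

Lemma mass_set0 : mass T set0 = 0.
Proof.
apply/eqP; rewrite eq_le mass_ge0 andbT.
apply: ge_ereal_sup => _ [m [f [pi [fV f1 pi1 ->]]]].
rewrite lee_fin big1// => l _.
have -> : f l = fun=> 0%R.
  apply/funext => x; apply/eqP/negPn/negP => /sub_spt.
  by have [_] := fV l; exact.
by apply: functional0 => // i; apply: lipschitz_map_on_bounded; exists 1%R; exact: pi1.
Qed.

Lemma mass_measure_set0 : mass_measure T set0 = 0.
Proof.
apply/eqP; rewrite eq_le mass_measure_ge0 andbT -mass_set0.
by apply: mass_measure_le => //; exact: open0.
Qed.

End Mass.

(** * Push-forward of mass and boundary *)

Section Push.
Variables (R : realType) (X Y : metricType R) (psi : X -> Y) (phi : Y -> X).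
Hypotheses (psiK : cancel psi phi) (phiK : cancel phi psi).
Hypotheses (psi_lip : lipschitz_on_bounded psi) (phi_lip : lipschitz_on_bounded phi).

Lemma push_currentK n (T : functional X n) :
  push_current phi (push_current psi T) = T.
Proof.
apply/funext => f; apply/funext => pi; rewrite /push_current; congr T.
  by apply/funext => x /=; rewrite psiK.
by apply/funext => i; apply/funext => x /=; rewrite psiK.
Qed.

Lemma dfwith_comp n (pi : 'I_n -> Y -> R) i (u : Y -> R) :
  (fun j => dfwith pi i u j \o psi) = dfwith (fun j => pi j \o psi) i (u \o psi).
Proof. by apply/funext => j; case: dfwithP => [|k ik]; rewrite ?dfwithin// dfwithout. Qed.

Let psi_cont : continuous psi.
Proof. exact: lipschitz_on_bounded_continuous. Qed.

Let test_comp (f : Y -> R) : test_fun f -> test_fun (f \o psi).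
Proof. exact: test_fun_comp psiK psi_lip phi_lip f. Qed.

Let ll_comp (p : Y -> R) : loc_lip p -> loc_lip (p \o psi).
Proof. exact: loc_lip_comp. Qed.

Let open_pre (V : set Y) : open V -> open (psi @^-1` V).
Proof. by apply: open_comp => x _; exact: psi_cont. Qed.

Lemma set_nbhs_preimage (A B : set Y) :
  set_nbhs A B -> set_nbhs (psi @^-1` A) (psi @^-1` B).
Proof.
move=> /set_nbhsP[C [oC AC CB]]; apply/set_nbhsP; exists (psi @^-1` C).
by split; [exact: open_pre|move=> x /AC|move=> x /CB].
Qed.

Lemma set_nbhs_sub (A A' B : set X) : A' `<=` A -> set_nbhs A B -> set_nbhs A' B.
Proof.
move=> A'A /set_nbhsP[C [oC AC CB]]; apply/set_nbhsP; exists C; split => //.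
exact: subset_trans AC.
Qed.

Lemma push_metric_functional n (T : functional X n) :
  metric_functional T -> metric_functional (push_current psi T).
Proof.
move=> [[T1 T2] Tloc Tcont]; split.
- split=> [a f g pi tf tg pl|a f pi i u v tf pl ul vl].
    by apply: T1 => [||i]; [exact: test_comp|exact: test_comp|exact: ll_comp].
  rewrite /push_current !dfwith_comp; apply: T2 => [|j||].
  + exact: test_comp.
  + exact: ll_comp.
  + exact: ll_comp.
  + exact: ll_comp.
- move=> f pi tf pl [i [c /set_nbhs_preimage ic]]; apply: Tloc => [|j|].
  + exact: test_comp.
  + exact: ll_comp.
  + by exists i, c.
- move=> f pik pi tf pkl pl pkc pkL; apply: Tcont => [|k j|j|j x|B Bb].
  + exact: test_comp.
  + exact: ll_comp.
  + exact: ll_comp.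
  + exact: pkc.
  + have [L pL] := pkL _ (lipschitz_on_bounded_image psi_lip Bb).
    have [K K1 psiL] := lipschitz_on_bounded_ge1 psi_lip Bb.
    exists (Num.max L 0 * K) => k i x y Bx By.
    apply: (@le_trans _ _ (Num.max L 0 * mdist (psi x) (psi y))).
      apply: le_trans (pL k i _ _ (imageP _ Bx) (imageP _ By)) _.
      by rewrite ler_wpM2r ?mdist_ge0// le_max lexx.
    by rewrite -mulrA ler_wpM2l ?le_max ?lexx ?orbT//; exact: psiL.
Qed.

Section Mass.
Variables (n : nat) (T : functional X n).
Hypothesis Tmf : metric_functional T.
Local Open Scope ereal_scope.

Lemma mass_push (V : set Y) (L : R) : open V -> metric_bounded V -> (1 <= L)%R ->
  lipschitz_in L (psi @^-1` V) psi ->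
  mass (push_current psi T) V <= (L ^+ n)%:E * mass T (psi @^-1` V).
Proof.
move=> oV Vb L1 psiL; have L0 : (0 < L)%R by lra.
apply: ge_ereal_sup => _ [m [f [pi [fV f1 pi1 ->]]]].
have pil l i : loc_lip (pi l i).
  by apply: lipschitz_map_on_bounded; exists 1%R; exact: pi1.
have tf l : test_fun (f l \o psi) by apply: test_comp; case: (fV l).
have sf l : spt (f l \o psi) `<=` psi @^-1` V.
  by move=> x /(spt_comp psi_lip) fx; apply: (fV l).2.
have /choice[q /all_and2[q1 qE]] l : exists q : 'I_n -> X -> R,
    (forall i, lipschitz_in 1 setT (q i : X -> R^o)) /\
    forall f, test_fun f -> spt f `<=` psi @^-1` V ->
      T f (fun i => pi l i \o psi) = (L ^+ n * T f q)%R.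
  apply: (functional_lipschitz1 Tmf) => // [|i|i x y Vx Vy].
  - exact: open_pre.
  - exact: ll_comp.
  - apply: (le_trans (pi1 l i (psi x) (psi y) I I)).
    by rewrite mul1r; exact: psiL.
have -> : (\sum_(l < m) push_current psi T (f l) (pi l) =
           L ^+ n * \sum_(l < m) T (f l \o psi) (q l))%R.
  by rewrite mulr_sumr; apply: eq_bigr => l _; rewrite -qE.
rewrite EFinM lee_pmul2l ?lte_fin ?exprn_gt0//.
by apply: mass_ge => // x; exact: f1.
Qed.

(** An open U around psi^-1 B is carried to Y by phi^-1 and cut with the bounded open [N] around A,
    where [mass_push] applies. The constant comes from [N], hence is the same for all B inside A. *)
Lemma mass_measure_push (A : set Y) : metric_bounded A ->
  exists2 C : R, (0 < C)%R & forall B, B `<=` A ->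
    mass_measure (push_current psi T) B <= C%:E * mass_measure T (psi @^-1` B).
Proof.
move=> Ab; have [N [oN Nb AN']] := metric_bounded_nbhd Ab.
have AN : A `<=` N by move=> a Aa; apply: AN' Aa _; rewrite mdistxx.
have [L L1 psiL] := lipschitz_on_bounded_ge1 psi_lip
  (lipschitz_on_bounded_preimage psiK phi_lip Nb).
have Ln : (0 < L ^+ n)%R by rewrite exprn_gt0//; lra.
exists (L ^+ n)%R => // B BA.
rewrite -lee_pdivrMl//; apply: le_ereal_inf_tmp => _ [U [oU BU] <-].
rewrite lee_pdivrMl//.
pose V := phi @^-1` U `&` N.
have oV : open V.
  apply: openI => //; apply: open_comp => // x _.
  exact: lipschitz_on_bounded_continuous.
have BV : B `<=` V by move=> y By; split; [apply: BU; rewrite /= phiK|exact/AN/BA].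
apply: le_trans (mass_measure_le _ oV BV) _.
apply: le_trans (mass_push oV _ L1 _) _.
- by apply: metric_bounded_sub Nb => x [].
- by apply: lipschitz_in_sub psiL => // x [].
- rewrite lee_pmul2l ?lte_fin//; apply: mass_sub => x [/=].
  by rewrite psiK.
Qed.

Lemma locally_finite_mass_push :
  locally_finite_mass T -> locally_finite_mass (push_current psi T).
Proof.
move=> [_ Tfin]; split; first exact: push_metric_functional.
move=> V oV Vb; have Vb' := lipschitz_on_bounded_preimage psiK phi_lip Vb.
have [mV tight] := Tfin _ (open_pre oV) Vb'.
have [L L1 psiL] := lipschitz_on_bounded_ge1 psi_lip Vb'.
have Ln : (0 < L ^+ n)%R by rewrite exprn_gt0//; lra.
split.
  by apply: le_lt_trans (mass_push oV Vb L1 psiL) _; rewrite lte_mul_pinfty// lee_fin ltW.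
(* The factor L ^ n lost in [mass_push] is paid in advance. *)
move=> e e0; have [|C [cC CV mC]] := tight (e / L ^+ n)%R; first by rewrite divr_gt0.
have cC' : compact (psi @` C).
  by apply: continuous_compact => //; apply: continuous_subspaceT.
exists (psi @` C); split => //; first by move=> _ [x /CV Vx <-].
have oVC : open (V `\` psi @` C).
  rewrite setDE; apply: openI => //; apply: closed_openC.
  by apply: compact_closed => //; exact: metric_hausdorff.
apply: le_lt_trans (mass_push oVC _ L1 _) _.
- by apply: metric_bounded_sub Vb => x [].
- by apply: lipschitz_in_sub psiL => // x [].
apply: (@le_lt_trans _ _ ((L ^+ n)%:E * mass T (psi @^-1` V `\` C))).
  rewrite lee_pmul2l ?lte_fin//; apply: mass_sub => x [/= Vx xC]; split => // Cx.
  by apply: xC; exists x.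
by rewrite -lte_pdivlMl// -EFinM mulrC.
Qed.

End Mass.

(** Push-forward commutes with the boundary: if sigma is 1 near the support of f, then sigma o psi
    is 1 near that of f o psi. *)
Lemma boundary_push n (T : functional X n) :
  boundary_locally_finite_mass T ->
  boundary_locally_finite_mass (push_current psi T).
Proof.
case: n T => [//|n] T /= [S TS Sfin]; exists (push_current psi S); last first.
  by apply: locally_finite_mass_push => //; case: Sfin.
move=> f pi sigma tf pl tsigma fsigma; rewrite /push_current.
rewrite (TS _ _ (sigma \o psi))//.
- congr T; apply/funext => i; rewrite /fcons.
  by case: (unlift ord0 i).
- exact: test_comp.
- by move=> i; exact: ll_comp.
- exact: test_comp.
- apply: (set_nbhs_sub (@spt_comp _ _ _ _ psi_lip f)).
  exact: set_nbhs_preimage fsigma.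
Qed.

End Push.

Lemma mass_measure_preimage_le (R : realType) (X Y : metricType R) (psi : X -> Y)
    (phi : Y -> X) n (T : functional X n) (A : set Y) :
  cancel psi phi -> cancel phi psi -> lipschitz_on_bounded psi ->
  lipschitz_on_bounded phi -> metric_functional T -> metric_bounded A ->
  exists2 C : R, 0 < C & forall B, B `<=` A ->
    (mass_measure T (psi @^-1` B) <= C%:E * mass_measure (push_current psi T) B)%E.
Proof.
move=> psiK phiK psi_lip phi_lip Tmf Ab.
have Smf := push_metric_functional psiK psi_lip phi_lip Tmf.
have [C C0 TS] := mass_measure_push phiK psiK phi_lip psi_lip Smf
  (lipschitz_on_bounded_preimage psiK phi_lip Ab).
rewrite push_currentK// in TS; exists C => // B BA.
have := TS (psi @^-1` B) (fun x Bx => BA _ Bx).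
by rewrite (_ : phi @^-1` _ = B)//; apply/seteqP; split => y /=; rewrite phiK.
Qed.

(** * Partitions of unity and null sets *)

Section Hat.
Variable R : realType.

Definition ramp (k : nat) (t : R) : R := Num.max 0 (Num.min 1 (t + 1 - k%:R)).

(* The hats [hat k], supported in [k - 1, k + 1], form a partition of unity of
   the half line. *)
Definition hat (k : nat) (t : R) : R := ramp k t - ramp k.+1 t.

Lemma rampP k t : [\/ t + 1 <= k%:R /\ ramp k t = 0, k%:R <= t /\ ramp k t = 1 |
  k%:R - 1 <= t <= k%:R /\ ramp k t = t + 1 - k%:R].
Proof.
rewrite /ramp; move: (k%:R : R) => a; case: (leP 1 (t + 1 - a)) => h.
  by constructor 2; rewrite max_r//; split => //; lra.
case: (leP 0 (t + 1 - a)) => h'; first by constructor 3; split => //; lra.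
by constructor 1; split => //; lra.
Qed.

Lemma ramp_lipschitz k (s t : R) : `|ramp k s - ramp k t| <= `|s - t|.
Proof.
have [st|st] := leP 0 (s - t); [rewrite (ger0_norm st)|rewrite (ltr0_norm st)].
all: case: (rampP k s) => -[] h1 ->; case: (rampP k t) => -[] h2 ->.
all: rewrite ler_norml; lra.
Qed.

Lemma hat_lipschitz k (s t : R) : `|hat k s - hat k t| <= 2 * `|s - t|.
Proof.
have := ramp_lipschitz k s t; have := ramp_lipschitz k.+1 s t.
rewrite /hat; have -> : ramp k s - ramp k.+1 s - (ramp k t - ramp k.+1 t) =
  (ramp k s - ramp k t) - (ramp k.+1 s - ramp k.+1 t) by ring.
have := ler_normB (ramp k s - ramp k t) (ramp k.+1 s - ramp k.+1 t); lra.
Qed.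

Lemma hat_ge0_le1 k (t : R) : 0 <= hat k t <= 1.
Proof.
rewrite /hat; case: (rampP k t) => -[] h1 ->; case: (rampP k.+1 t) => -[] h2 ->.
all: move: h1 h2; rewrite -natr1; lra.
Qed.

Lemma hat_neq0 k (t : R) : hat k t != 0 -> k%:R - 1 <= t <= k%:R + 1.
Proof.
apply: contraR; rewrite negb_and -!ltNge /hat => /orP h.
case: (rampP k t) => -[] h1 ->; case: (rampP k.+1 t) => -[] h2 ->.
all: rewrite -natr1 in h2 *; apply/eqP; case: h; lra.
Qed.

(** The sum telescopes to [ramp 0 t - ramp m t], and the two bounds on t make this 1 - 0. *)
Lemma hat_sum m (t : R) : 0 <= t -> t + 1 <= m%:R -> \sum_(k < m) hat k t = 1.
Proof.
move=> t0 tm.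
have -> : \sum_(k < m) hat k t = ramp 0 t - ramp m t.
  elim: (m) => [|k IH]; first by rewrite big_ord0 subrr.
  by rewrite big_ord_recr /= IH /hat; lra.
case: (rampP 0 t) => -[] h1 ->; case: (rampP m t) => -[] h2 ->; lra.
Qed.

Lemma loc_lip_hat (X : metricType R) k (u : X -> R) : loc_lip u ->
  loc_lip (fun x => hat k (u x)).
Proof. by move=> ul; apply: (loc_lip_compR ul (K := 2)); exact: hat_lipschitz. Qed.

End Hat.

Lemma geometric_sum_le (R : realType) (e : R) m : 0 <= e ->
  \sum_(k < m) e / 2 ^+ k.+1 <= e.
Proof.
move=> e0; suff -> : \sum_(k < m) e / 2 ^+ k.+1 = e - e / 2 ^+ m.
  by rewrite gerBl divr_ge0// exprn_ge0.
elim: m => [|m IH]; first by rewrite big_ord0 expr0 divr1 subrr.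
rewrite big_ord_recr /= IH exprS; field.
by rewrite expf_neq0.
Qed.

Section Shells.
Variables (R : realType) (Y : metricType R) (n : nat) (S : functional Y n).
Hypothesis Smf : metric_functional S.

(** A replacement for countable subadditivity. A family competing for the mass on V is multiplied by
    [hat k (mdist y0 y)]; for each k the products compete on the k-th shell, because the closed
    range [k - 1, k + 1] of distances lies in the open one of half-width 2. Finitely many k are
    enough, the supports being bounded. *)
Lemma mass_shells (y0 : Y) (V : set Y) (a : nat -> R) (e : R) :
  (forall k, (mass S (V `&` [set y | (k%:R - 2 < mdist y0 y < k%:R + 2)%R])
               <= (a k)%:E)%E) ->
  (forall m, \sum_(k < m) a k <= e) -> (mass S V <= e%:E)%E.
Proof.
move=> Sa ae; apply: ge_ereal_sup => _ [m [f [pi [fV f1 pi1 ->]]]].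
have tf l : test_fun (f l) by case: (fV l).
have pil l i : loc_lip (pi l i).
  by apply: lipschitz_map_on_bounded; exists 1; exact: pi1.
have [r r0 fr] : exists2 r, 0 <= r & forall l y, f l y != 0 -> mdist y0 y < r.
  have bd l : exists r, 0 < r /\ forall y, f l y != 0 -> mdist y0 y < r.
    have [r r0 fr] := metric_boundedP y0 (let: And3 _ _ b := tf l in b).
    by exists r; split => // y /sub_spt /fr.
  (* The sum of the individual radii serves as a common radius. *)
  exists (\sum_l sval (cid (bd l))).
    by apply: sumr_ge0 => l _; case: cid => ? [/= ? _]; exact: ltW.
  move=> l y fy; apply: (@lt_le_trans _ _ (sval (cid (bd l)))).
    by case: cid => ? [_] /= ; exact.
  rewrite [leRHS](bigD1 l)//= lerDl.
  by apply: sumr_ge0 => l' _; case: cid => ? [/= ? _]; exact: ltW.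
pose K := (Num.truncn (r + 1)).+1.
have rK : r + 1 <= K%:R by rewrite ltW// truncnS_gt.
pose F l (k : nat) y := f l y * hat k (mdist y0 y).
have tF l k : test_fun (F l k).
  by apply: test_funM => //; apply: loc_lip_hat; exact: loc_lip_mdist.
have -> : \sum_(l < m) S (f l) (pi l) = \sum_(k < K) \sum_(l < m) S (F l k) (pi l).
  rewrite exchange_big; apply: eq_bigr => l _ /=.
  rewrite -functional_sum//; congr S; apply/funext => y.
  rewrite -mulr_sumr; have [->|fy] := eqVneq (f l y) 0; first by rewrite mul0r.
  by rewrite hat_sum ?mulr1 ?mdist_ge0//; have := fr l y fy; lra.
rewrite lee_fin; apply: le_trans (ae K); apply: ler_sum => k _.
rewrite -lee_fin; apply: le_trans (Sa k); apply: mass_ge => // [l y|y].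
  move=> Fy; split; first by apply: (fV l).2; exact: spt_mul Fy.
  have : [set y | k%:R - 1 <= mdist y0 y <= k%:R + 1] y.
    move: Fy; apply: spt_sub.
      rewrite (_ : [set _ | _] = mdist y0 @^-1` [set` `[k%:R - 1, k%:R + 1]]).
        apply: preimage_closed; last exact: interval_closed.
        by move=> z _; exact/loc_lip_continuous/loc_lip_mdist.
      by apply/seteqP; split => z /=; rewrite in_itv.
    move=> z; rewrite /F /= mulf_eq0 negb_or => /andP[_]; exact: hat_neq0.
  by move=> /=; lra.
apply: le_trans (f1 y); apply: ler_sum => l _; rewrite /F normrM.
rewrite -[leRHS]mulr1 ler_wpM2l//; have := hat_ge0_le1 k (mdist y0 y).
by move=> /andP[h0 h1]; rewrite ger0_norm.
Qed.

End Shells.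

Section NullPush.
Variables (R : realType) (X Y : metricType R) (psi : X -> Y) (phi : Y -> X).
Hypotheses (psiK : cancel psi phi) (phiK : cancel phi psi).
Hypotheses (psi_lip : lipschitz_on_bounded psi) (phi_lip : lipschitz_on_bounded phi).
Variables (n : nat) (T : functional X n).
Hypothesis Tmf : metric_functional T.
Local Open Scope ereal_scope.

(* A neighbourhood [V] of [phi @^-1` A] of small mass is obtained by matching, on
   the k-th shell around [y0], a neighbourhood of [A] whose mass is small compared
   to the Lipschitz constant of [psi] on that shell. *)
Lemma null_push (A : set X) :
  mass_measure T A = 0 -> mass_measure (push_current psi T) (phi @^-1` A) = 0.
Proof.
move=> TA0; have Smf := push_metric_functional psiK psi_lip phi_lip Tmf.
have [->|/set0P[y0 _]] := eqVneq (phi @^-1` A) set0; first exact: mass_measure_set0.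
apply/eqP; rewrite eq_le mass_measure_ge0 andbT; apply/lee_addgt0Pr => e e0.
rewrite add0e.
have bd k := lipschitz_on_bounded_preimage psiK phi_lip
  (@metric_bounded_mdist_lt _ _ y0 (k%:R + 2)).
have /choice[L /all_and2[L1 psiL]] k : exists L : R, (1 <= L)%R /\
    lipschitz_in L (psi @^-1` [set y | (mdist y0 y < k%:R + 2)%R]) psi.
  by have [L] := lipschitz_on_bounded_ge1 psi_lip (bd k); exists L.
have Ln k : (0 < L k ^+ n)%R by rewrite exprn_gt0//; have := L1 k; lra.
(* After the loss of L k ^ n in [mass_push], shell k contributes at most e / 2 ^ (k + 1). *)
pose d k := (e / 2 ^+ k.+1 / L k ^+ n)%R.
have d0 k : (0 < d k)%R by rewrite !divr_gt0// exprn_gt0.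
have /choice[U /all_and3[oU AU TU]] k : exists U : set X,
    [/\ open U, A `<=` U & mass T U <= (d k)%:E].
  have : mass_measure T A < (d k)%:E by rewrite TA0 lte_fin.
  by move=> /ereal_inf_lt[_ [U [oU AU] <-] /ltW TU]; exists U.
pose W k := \bigcap_(j < k.+1) phi @^-1` (U j).
have oW k : open (W k).
  rewrite /W bigcap_mkord; elim/big_ind : _ => //; [exact: openT|exact: openI|].
  move=> j _; apply: open_comp => // y _; exact: lipschitz_on_bounded_continuous.
have ball_open (r : R) : open [set y | (mdist y0 y < r)%R].
  apply/open_mdistP => y /= yr; exists (r - mdist y0 y)%R; first by rewrite subr_gt0.
  by move=> z yz; have := metric_triangle y0 y z; lra.
(* A point of shell k in the j-th piece satisfies k - 2 < j, so k is among the indices below j + 3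
   that are intersected in [W j.+2], and the point lies in phi^-1 (U k). *)
pose V := \bigcup_j (W j.+2 `&` [set y | (mdist y0 y < j%:R)%R]).
have oV : open V by apply: bigcup_open => j _; exact: openI.
have AV : phi @^-1` A `<=` V.
  move=> y Ay; exists (Num.truncn (mdist y0 y)).+1 => //; split.
    by move=> j _; exact: AU.
  by rewrite /= truncnS_gt.
apply: le_trans (mass_measure_le _ oV AV) _.
apply: (mass_shells (y0 := y0) Smf (a := fun k => (e / 2 ^+ k.+1)%R)); last first.
  by move=> m; apply: geometric_sum_le; exact: ltW.
move=> k; set Vk := V `&` _.
have Vk_sub : Vk `<=` [set y | (mdist y0 y < k%:R + 2)%R] by move=> y [_ /andP[]].
have oVk : open Vk.
  rewrite (_ : Vk = V `&` [set y | (mdist y0 y < k%:R + 2)%R] `&`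
                   [set y | (k%:R - 2 < mdist y0 y)%R]); last first.
    by apply/seteqP; split => y /=;
      [move=> [? /andP[]]|move=> [[? ?] ?]; split => //; apply/andP].
  apply: openI; first exact: openI.
  apply/open_mdistP => y /= yr; exists (mdist y0 y - (k%:R - 2))%R.
    by rewrite subr_gt0.
  move=> z yz; have := metric_triangle y0 z y; rewrite (metric_sym z y); lra.
apply: le_trans (mass_push psiK psi_lip phi_lip Tmf oVk _ (L1 k) _) _.
- by apply: metric_bounded_sub Vk_sub _; exact: metric_bounded_mdist_lt.
- by apply: lipschitz_in_sub (psiL k) => // x /Vk_sub.
rewrite -lee_pdivlMl//; apply: (@le_trans _ _ (d k)%:E); last first.
  by rewrite -EFinM lee_fin /d mulrC.
apply: le_trans (TU k); apply: mass_sub => x [[j _ [Wj /= xj]] /andP[kx _]].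
have kj : (k < j.+3)%N by rewrite -(ltr_nat R) -!natr1; lra.
by have /= := Wj k kj; rewrite psiK.
Qed.

End NullPush.

(** * Integration and Borel extension *)

(* The outer measure [mass_measure T] is integrated as a bare set function: no
   additivity is assumed below. *)
Section BareIntegral.
Context d (T : measurableType d) (R : realType).
Variable mu : set T -> \bar R.
Hypotheses (mu0 : mu set0 = 0%E) (mu_ge0 : forall A, (0 <= mu A)%E).
Local Open Scope ereal_scope.
Import HBNNSimple.

(** The integral is a supremum for the positive part minus one for the negative part. Only the zero
    simple function lies below the latter, and its other level sets are empty, hence the hypothesis
    on [mu set0]. *)
Lemma integral_supE (f : T -> \bar R) : (forall x, 0 <= f x) ->
  \int[mu]_x f x = ereal_sup [set sintegral mu h |
    h in [set h : {nnsfun T >-> R} | forall x, (h x)%:E <= f x]].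
Proof.
move=> f0; rewrite /integral patch_setT.
have -> : (fun x => f x)^\+ = f.
  by apply/funext => x; rewrite (@ge0_funeposE _ _ setT) ?inE.
have -> : (fun x => f x)^\- = cst 0.
  by apply/funext => x; rewrite (@ge0_funenegE _ _ setT) ?inE.
have s0 (h : T -> R) : (forall x, h x = 0%R) -> sintegral mu h = 0.
  move=> h0; apply: fsbig1 => x _; have [->|x0] := eqVneq x 0%R; first by rewrite mul0e.
  rewrite (_ : _ @^-1` _ = set0) ?mu0 ?mule0//; apply/seteqP; split => // y /=.
  by rewrite h0 => /esym/eqP; rewrite (negbTE x0).
set S := ereal_sup _; set S' := ereal_sup _; suff -> : S' = 0 by rewrite sube0.
apply/eqP; rewrite eq_le; apply/andP; split.
  apply: ge_ereal_sup => _ [h /= h0 <-]; rewrite s0// => x.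
  by apply/eqP; rewrite eq_le fun_ge0 andbT -lee_fin.
by apply: le_ereal_sup_tmp; exists 0 => //; exists nnsfun0 => //; rewrite s0.
Qed.

Lemma le_bare_integral (f g : T -> \bar R) : (forall x, 0 <= f x) ->
  (forall x, f x <= g x) -> \int[mu]_x f x <= \int[mu]_x g x.
Proof.
move=> f0 fg; rewrite !integral_supE//; last by move=> x; exact: le_trans (f0 x) (fg x).
by apply: ereal_sup_le => _ [h /= hf <-]; exists h => //= x; exact: le_trans (hf x) (fg x).
Qed.

Lemma bare_integral_ge0 (f : T -> \bar R) : (forall x, 0 <= f x) ->
  0 <= \int[mu]_x f x.
Proof.
move=> f0; rewrite integral_supE//; apply: le_ereal_sup_tmp.
exists (sintegral mu (@nnsfun0 _ T R)); first by exists nnsfun0.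
apply: fsume_ge0 => x _; have [x0|x0] := leP 0%R x; first by rewrite mule_ge0.
rewrite (_ : _ @^-1` _ = set0) ?mu0 ?mule0//; apply/seteqP; split => // y /= xE.
by move: x0; rewrite -xE ltxx.
Qed.

(** [sintegral] sees a simple function only through its level sets. Since the W j are disjoint and
    the a j distinct and nonzero, the level set of [s] at a j is exactly W j, so the left side is
    part of [sintegral mu s] without any additivity of mu. *)
Lemma sum_le_bare_integral M (a : nat -> R) (W : nat -> set T) (f : T -> \bar R) :
  (forall j, measurable (W j)) -> (forall j, 0 < a j)%R -> injective a ->
  (forall i j x, W i x -> W j x -> i = j) ->
  (forall x, 0 <= f x) -> (forall j x, W j x -> (a j)%:E <= f x) ->
  \sum_(j < M) (a j)%:E * mu (W j) <= \int[mu]_x f x.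
Proof.
move=> mW a0 a_inj Wdisj f0 Wf.
pose s := sum_nnsfun (fun j => scale_nnsfun (indic_nnsfun R (mW j)) (ltW (a0 j))) M.
have sE x : (s x = \sum_(j < M) a j * \1_(W j) x)%R by rewrite sum_nnsfunE.
have s_in j x : (j < M)%N -> W j x -> s x = a j.
  move=> jM Wjx; rewrite sE (bigD1 (Ordinal jM))//= indicE mem_set// mulr1.
  rewrite big1 ?addr0// => i ij; rewrite indicE memNset ?mulr0// => Wix.
  by move: ij; rewrite -val_eqE /= (Wdisj _ _ _ Wix Wjx) eqxx.
have s_out x : (forall j, (j < M)%N -> ~ W j x) -> s x = 0%R.
  by move=> nW; rewrite sE big1// => i _; rewrite indicE memNset ?mulr0//; exact: nW.
have s_cases x : (exists2 j, (j < M)%N & W j x) \/ s x = 0%R.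
  have [?|nW] := pselect (exists2 j, (j < M)%N & W j x); [by left|right].
  by apply: s_out => j jM Wj; apply: nW; exists j.
have s_pre j : (j < M)%N -> s @^-1` [set a j] = W j.
  move=> jM; apply/seteqP; split => x /=; last exact: s_in.
  case: (s_cases x) => [[i iM Wi]|->]; first by rewrite (s_in i)// => /a_inj <-.
  by move=> aj; move: (a0 j); rewrite -aj ltxx.
rewrite integral_supE//; apply: le_ereal_sup_tmp; exists (sintegral mu s).
  exists s => //= x; case: (s_cases x) => [[i iM Wi]|->//].
  by rewrite (s_in i)//; exact: Wf.
pose F x := x%:E * mu (s @^-1` [set x]).
have F0 x : 0 <= F x.
  have [x0|x0] := leP 0%R x; first by rewrite mule_ge0.
  rewrite /F (_ : _ @^-1` _ = set0) ?mu0 ?mule0//; apply/seteqP; split => // y /= xE.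
  by move: x0; rewrite -xE ltNge fun_ge0.
rewrite (eq_bigr (fun j : 'I_M => F (a j))); last by move=> j _; rewrite /F s_pre.
have -> : \sum_(j < M) F (a j) = \sum_(x \in a @` `I_M) F x.
  rewrite fsbig_image; first by rewrite (fsbig_ord _ _ (fun j => F (a j))).
  by move=> i j _ _ /a_inj.
have fin1 : finite_set (a @` `I_M) by exact/finite_image/finite_II.
rewrite /sintegral -(fsbig_widen (range s `|` a @` `I_M) setT)//; last first.
  move=> x [_ /not_orP[xs _]] /=; rewrite (_ : _ @^-1` _ = set0) ?mu0 ?mule0//.
  by apply/seteqP; split => // y /= sy; apply: xs; exists y.
apply: lee_fsum_nneg_subset => //.
- by rewrite finite_setU; split => //; exact: fimfunP.
- by move=> x; rewrite !inE => ?; right.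
Qed.

End BareIntegral.

Section BareIntegralComp.
Context d1 (T1 : measurableType d1) d2 (T2 : measurableType d2) (R : realType).
Variables (mu1 : set T1 -> \bar R) (mu2 : set T2 -> \bar R).
Hypothesis mu10 : mu1 set0 = 0%E.
Hypotheses (mu20 : mu2 set0 = 0%E) (mu2_ge0 : forall A, (0 <= mu2 A)%E).
Variables (psi : T1 -> T2) (phi : T2 -> T1).
Hypotheses (psiK : cancel psi phi) (phiK : cancel phi psi).
Hypothesis mphi : measurable_fun setT phi.
Local Open Scope ereal_scope.
Import HBSimple HBNNSimple.

(** A simple function h below f o psi becomes h o phi below f, with corresponding level sets. Those
    at positive levels lie in A, as f vanishes elsewhere, so the comparison of mu1 and mu2 is
    applied only inside A. *)
Lemma bare_integral_comp_le (C : R) (A : set T2) (f : T2 -> \bar R) :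
  (0 < C)%R -> (forall B, B `<=` A -> mu1 (psi @^-1` B) <= C%:E * mu2 B) ->
  (forall y, 0 <= f y) -> (forall y, ~ A y -> f y = 0) ->
  \int[mu1]_x f (psi x) <= C%:E * \int[mu2]_y f y.
Proof.
move=> C0 mu12 f0 fA; rewrite integral_supE//.
apply: ge_ereal_sup => _ [h /= hf <-].
have mh : measurable_fun setT (h \o phi) by exact: measurableT_comp.
have fh : finite_set (range (h \o phi)).
  by apply: (@sub_finite_set _ _ (range h)) => [_ [y _ <-]|]; [exists (phi y)|exact: fimfunP].
have nh y : (0 <= (h \o phi) y)%R by exact: fun_ge0.
pose mh' := @isMeasurableFun.Build _ _ T2 R (h \o phi) mh.
pose fh' := @FiniteImage.Build T2 R (h \o phi) fh.
pose nh' := @isNonNegFun.Build T2 R (h \o phi) nh.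
pose s : {nnsfun T2 >-> R} := HB.pack (h \o phi) mh' fh' nh'.
have fin : finite_set (range h) by exact: fimfunP.
have h_out (x : R) : ~ range h x -> s @^-1` [set x] = set0.
  by move=> xh; apply/seteqP; split => // y /= hy; apply: xh; exists (phi y).
have hE (x : R) : h @^-1` [set x] = psi @^-1` (s @^-1` [set x]).
  by apply/seteqP; split => y /=; rewrite psiK.
apply: (@le_trans _ _ (C%:E * sintegral mu2 s)); last first.
  rewrite lee_pmul2l ?lte_fin// integral_supE//; apply: le_ereal_sup_tmp.
  exists (sintegral mu2 s) => //; exists s => //= y.
  by have := hf (phi y); rewrite phiK.
rewrite /sintegral -(fsbig_widen (range h) setT)//; last first.
  by move=> x [_ xh] /=; rewrite hE h_out// preimage_set0 mu10 mule0.
rewrite -[X in _ <= C%:E * X](fsbig_widen (range h) setT)//; last first.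
  by move=> x [_ xh] /=; rewrite h_out// mu20 mule0.
have x0P (x : R) : range h x -> (0 <= x)%R by move=> [y _ <-]; exact: fun_ge0.
rewrite ge0_mule_fsumr; last first.
  move=> x; have [/x0P x0|xh] := pselect (range h x); first by rewrite mule_ge0.
  by rewrite h_out// mu20 mule0.
apply: lee_fsum => // x /x0P.
rewrite le_eqVlt => /predU1P[<-|x0]; first by rewrite !mul0e mule0.
rewrite muleCA lee_pmul2l ?lte_fin// hE; apply: mu12 => y /= hy.
apply: contrapT => /fA fy0; have := hf (phi y).
by rewrite phiK fy0 lee_fin hy leNgt x0.
Qed.

End BareIntegralComp.

Section BorelPreimage.
Variables (R : realType) (X Y : metricType R) (phi : Y -> X).
Hypothesis phi_cont : continuous phi.

Lemma borel_set_preimage (B : set X) : borel_set B -> borel_set (phi @^-1` B).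
Proof.
suff : <<s @open X >> `<=` [set A | borel_set (phi @^-1` A)] by exact.
apply: smallest_sub => [|U oU /=].
  split => [|A bA|F bF] /=.
  - by rewrite preimage_set0; exact: sigma_algebra0.
  - exact: (sigma_algebraCD bA).
  - by rewrite preimage_bigcup; exact: sigma_algebra_bigcup.
by apply: sub_sigma_algebra; apply: open_comp => // x _; exact: phi_cont.
Qed.

Lemma borel_measurable_fun (x0 : X) (y0 : Y) :
  measurable_fun setT (phi : borel_space Y y0 -> borel_space X x0).
Proof. by move=> _ B mB; rewrite setTI; exact: borel_set_preimage. Qed.

End BorelPreimage.

Section IntegralBound.
Variables (R : realType) (X : metricType R) (n : nat) (T : functional X n).
Hypothesis Tmf : metric_functional T.
Local Open Scope ereal_scope.

Let mu := mass_measure T.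
Let mu0 : mu set0 = 0. Proof. exact: mass_measure_set0. Qed.
Let mu_ge0 A : 0 <= mu A. Proof. exact: mass_measure_ge0. Qed.

Lemma sume_mod4 (G : nat -> \bar R) M :
  \sum_(i < 4 * M) G i = \sum_(j < M) G (4 * j)%N + \sum_(j < M) G (4 * j).+1 +
    (\sum_(j < M) G (4 * j).+2 + \sum_(j < M) G (4 * j).+3).
Proof.
rewrite -!big_split /=; elim: M => [|M IH]; first by rewrite muln0 !big_ord0.
rewrite mulnS !addSn add0n 4!big_ord_recr /= IH [in RHS]big_ord_recr /=.
by rewrite !addeA.
Qed.

(* [h] is cut into the layers [h * hat k (h / e)]; each is controlled by the mass
   of the open set [W i] that contains its support. Sets [W i] whose indices
   agree modulo 4 are disjoint, so for each residue the sum of the bounds is the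
   integral of a simple function below [h]. *)
Lemma functional_le_integral_ge0 (x0 : X) (D : set X) (h : X -> R)
    (sigma : 'I_n -> X -> R) :
  mass T D < +oo -> test_fun h -> (forall x, 0 <= h x)%R -> spt h `<=` D ->
  (forall i, lipschitz_in 1 setT (sigma i : X -> R^o)) ->
  `|T h sigma|%:E <= 16%:E *
    (\int[mu : set (borel_space X x0) -> \bar R]_x (h x)%:E).
Proof.
move=> TD th h0 hD sigma1.
have sl i : loc_lip (sigma i).
  by apply: lipschitz_map_on_bounded; exists 1%R; exact: sigma1.
set I := \int[_]_x _.
pose K := (fine (mass T D)).
have TDK : mass T D = K%:E by rewrite fineK// ge0_fin_numE// mass_ge0.
have K0 : (0 <= K)%R by rewrite -lee_fin -TDK mass_ge0.
(* The three lowest layers are bounded by 3 * e each and so contribute at most 9 * e * K <= d. They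
   reach down to the zeros of h or close to them and are absorbed in the error d, using the finite
   mass of D. *)
apply/lee_addgt0Pr => d d0; pose e := (d / (9 * (K + 1)))%R.
have e0 : (0 < e)%R by rewrite divr_gt0//; lra.
have e_ge0 := ltW e0.
have [[N hN] hl hb] := (test_funP h).1 th.
(* With this M the hats below M already sum to 1 on the range of h / e. The number 3 + 4 * M of
   layers used below splits into the low ones and four residue classes. *)
pose M := (Num.truncn (N / e + 1)).+1.
have NM : (N / e + 1 <= M%:R)%R by rewrite ltW// truncnS_gt.
pose g k x := (h x * hat k (h x / e))%R.
have he_lip : loc_lip (fun x => h x / e)%R by exact: loc_lipM hl (@loc_lip_cst R X e^-1).
have tg k : test_fun (g k) by apply: test_funM => //; exact: loc_lip_hat.
have hE : h = (fun x => \sum_(k < 3 + 4 * M) g k x)%R.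
  apply/funext => x; rewrite -mulr_sumr hat_sum ?mulr1//.
    by rewrite divr_ge0// ltW.
  have hxN : (h x / e <= N / e)%R.
    by rewrite ler_pM2r ?invr_gt0//; have := hN x; rewrite ger0_norm.
  have : (M <= 3 + 4 * M)%N by lia.
  by rewrite -(ler_nat R); lra.
have g_le k x : (`|g k x| <= (k%:R + 1) * e)%R.
  have /andP[t0 t1] := hat_ge0_le1 k (h x / e).
  rewrite /g ger0_norm ?mulr_ge0//.
  have [->|/hat_neq0/andP[_]] := eqVneq (hat k (h x / e)) 0%R.
    by rewrite mulr0 mulr_ge0 ?addr_ge0// ltW.
  rewrite ler_pdivrMr// => hk; apply: le_trans hk.
  by rewrite ler_piMr.
have low : (`|\sum_(k < 3) T (g k) sigma| <= d)%R.
  apply: (@le_trans _ _ (\sum_(k < 3) (3 * e * K)))%R; last first.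
    rewrite sumr_const card_ord -mulrnAl -mulr_natr.
    have -> : (3 * e * 3%:R * K = d * (K / (K + 1)))%R.
      by rewrite /e; field; rewrite gt_eqF// ltr_wpDl.
    have KK : (K / (K + 1) <= 1)%R by rewrite ler_pdivrMr ?mul1r ?lerDl// ltr_wpDl.
    by rewrite ler_piMr// ltW.
  apply: le_trans (ler_norm_sum _ _ _) _; apply: ler_sum => k _.
  rewrite -lee_fin EFinM -TDK; apply: mass_bound => //; first by rewrite mulr_gt0.
    by apply: subset_trans hD; exact: spt_mul.
  move=> x; apply: le_trans (g_le k x) _; rewrite ler_wpM2r//.
  by have := ltn_ord k; rewrite -(ler_nat R) -natr1.
(* Layer i + 3 is supported where i + 2 <= h / e <= i + 4, inside [W i], and its height is at most
   (i + 4) * e <= 4 * a i, while h > a i on [W i]. This factor 4 and the four residue classes give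
   16. *)
pose a i := (i.+1%:R * e)%R.
pose W i := [set x | (i.+1%:R < h x / e < i.+1%:R + 4)%R].
have oW i : open (W i).
  rewrite (_ : W i = (fun x => h x / e)%R @^-1` [set` `](i.+1%:R), (i.+1%:R + 4)[%R]).
    apply: open_comp; last exact: interval_open.
    by move=> x _; exact/loc_lip_continuous.
  by apply/seteqP; split => x /=; rewrite in_itv.
have a0 i : (0 < a i)%R by rewrite /a mulr_gt0.
have g_spt i : spt (g (i + 3)%N) `<=` W i.
  have sub : spt (g (i + 3)%N) `<=`
      (fun x => h x / e)%R @^-1` [set` `[(i.+1%:R + 1), (i.+1%:R + 3)]%R].
    apply: spt_sub.
      apply: preimage_closed; last exact: interval_closed.
      by move=> x _; exact: loc_lip_continuous.
    move=> x /=; rewrite mulf_eq0 negb_or in_itv /= => /andP[_ /hat_neq0].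
    by rewrite natrD -natr1; lra.
  by move=> x /sub /=; rewrite in_itv /= /W /=; lra.
have color r : \sum_(j < M) (a (4 * j + r)%N)%:E * mu (W (4 * j + r)%N) <= I.
  apply: (@sum_le_bare_integral _ (borel_space X x0) R mu mu0 mu_ge0 M
    (fun j => a (4 * j + r)%N) (fun j => W (4 * j + r)%N)).
  - by move=> j; apply: sub_sigma_algebra; exact: oW.
  - by move=> j; exact: a0.
  - move=> i j /(mulIf (lt0r_neq0 e0))/eqP; rewrite eqr_nat => /eqP; lia.
  - have aux i j x : W (4 * i + r)%N x -> W (4 * j + r)%N x -> (i <= j)%N.
      rewrite /W /= => /andP[hi _] /andP[_ hj].
      have : ((4 * i + r).+1%:R < (4 * j + r).+1%:R + 4%:R :> R)%R by lra.
      by rewrite -natrD ltr_nat; lia.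
    by move=> i j x Wi Wj; apply/eqP; rewrite eqn_leq (aux i j x)// (aux j i x).
  - by move=> x; rewrite lee_fin.
  - move=> j x /andP[hj _]; rewrite lee_fin /a.
    by rewrite -ler_pdivlMr// ltW.
have I0 : 0 <= I by apply: bare_integral_ge0 => // x; rewrite lee_fin.
have high : \sum_(i < 4 * M) (a i)%:E * mu (W i) <= 4%:E * I.
  rewrite (sume_mod4 (fun i => (a i)%:E * mu (W i))).
  have -> : 4%:E * I = I + I + (I + I).
    rewrite (_ : 4%:E = 1 + 1 + (1 + 1) :> \bar R); last by rewrite -!EFinD; congr EFin; lra.
    by rewrite !ge0_muleDl ?mul1e ?adde_ge0.
  do !apply: leeD.
  - by apply: le_trans (color 0%N); under [leRHS]eq_bigr do rewrite addn0.
  - by apply: le_trans (color 1%N); under [leRHS]eq_bigr do rewrite addn1.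
  - by apply: le_trans (color 2%N); under [leRHS]eq_bigr do rewrite addn2.
  - by apply: le_trans (color 3%N); under [leRHS]eq_bigr do rewrite addn3.
rewrite [in leLHS]hE functional_sum// big_split_ord /=.
apply: (@le_trans _ _ (`|\sum_(i < 4 * M) T (g (3 + i)%N) sigma|%:E + d%:E)).
  rewrite -EFinD lee_fin [leRHS]addrC; apply: le_trans (ler_normD _ _) _.
  by rewrite lerD2r.
apply: leeD => //; apply: (@le_trans _ _ (\sum_(i < 4 * M) 4%:E * ((a i)%:E * mu (W i)))).
  apply: (@le_trans _ _ (\sum_(i < 4 * M) `|T (g (3 + i)%N) sigma|%:E)).
    by rewrite sumEFin lee_fin; exact: ler_norm_sum.
  apply: lee_sum => i _; rewrite muleA -EFinM.
  apply: (@le_trans _ _ ((4 * a i)%:E * mass T (W i))).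
    apply: mass_bound => //.
    - by rewrite mulr_gt0.
    - by rewrite addnC; exact: g_spt.
    - move=> x; apply: le_trans (g_le _ x) _; rewrite /a mulrA ler_wpM2r//.
      rewrite natrD -natr1; have : (0 <= i%:R :> R)%R by []; lra.
  by rewrite lee_wpmul2l ?mass_le_measure// lee_fin mulr_ge0// ltW.
rewrite -ge0_sume_distrr; last first.
  by move=> i _; rewrite mule_ge0// lee_fin ltW.
rewrite (_ : 16%:E = 4%:E * 4%:E :> \bar R); last by rewrite -EFinM; congr EFin; lra.
by rewrite -muleA lee_wpmul2l.
Qed.

End IntegralBound.

Lemma bounded_cutoff (R : realType) (X : metricType R) (A : set X) :
  metric_bounded A -> exists (chi : X -> R) (N : set X),
    [/\ test_fun chi, forall x, 0 <= chi x <= 1, forall x, A x -> chi x = 1,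
        open N /\ metric_bounded N & spt chi `<=` N].
Proof.
move=> Ab; have [->|/set0P[a _]] := eqVneq A set0.
  exists (fun=> 0), set0; split => //; first exact: test_fun0.
    by move=> x; rewrite lexx ler01.
  - by split; [exact: open0|exists 0].
  - apply: subset_trans (spt_sub (F := set0) _ _) _ => //; first exact: closed0.
    by move=> x /=; rewrite eqxx.
have [r r0 Ar] := metric_boundedP a Ab.
pose k := (Num.truncn (r + 1)).+1.
have rk : r + 1 <= k%:R by rewrite ltW// truncnS_gt.
pose chi x : R := 1 - ramp k (mdist a x).
have chi01 x : 0 <= chi x <= 1.
  by rewrite /chi; case: (rampP k (mdist a x)) => -[] h ->; lra.
have chi_lip : loc_lip chi.
  apply: loc_lipB; first exact: loc_lip_cst.
  apply: (loc_lip_compR (K := 1)); first exact: loc_lip_mdist.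
  by move=> s t; rewrite mul1r ramp_lipschitz.
have sub : spt chi `<=` [set y | mdist a y < k%:R + 1].
  have sub' : spt chi `<=` mdist a @^-1` [set y | y <= k%:R].
    apply: spt_sub.
      apply: preimage_closed; last exact: closed_le.
      by move=> x _; exact/loc_lip_continuous/loc_lip_mdist.
    move=> x /=; apply: contraR; rewrite -ltNge => kx; apply/eqP.
    by rewrite /chi; case: (rampP k (mdist a x)) => -[] h ->; lra.
  by move=> x /sub' /=; lra.
exists chi, [set y | mdist a y < k%:R + 1]; split => //.
- apply/test_funP; split => //.
    by exists 1 => x; have /andP[c0 c1] := chi01 x; rewrite ger0_norm.
  by apply: metric_bounded_sub sub _; exact: metric_bounded_mdist_lt.
- by move=> x /Ar /= xr; rewrite /chi; case: (rampP k (mdist a x)) => -[] h ->; lra.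
- split; last exact: metric_bounded_mdist_lt.
  apply/open_mdistP => y /= yr; exists (k%:R + 1 - mdist a y); first by rewrite subr_gt0.
  by move=> z yz; have := metric_triangle a y z; lra.
Qed.

(** * The L^1 estimate and the dependence of the Borel extension on the coordinates *)

Section BorelExt.
Variables (R : realType) (X : metricType R) (n : nat) (T : functional X n).
Hypothesis Tfin : locally_finite_mass T.

Let Tmf : metric_functional T. Proof. by case: Tfin. Qed.

(** The factor L ^ n comes from making sigma 1-Lipschitz near D, and 32 = 16 + 16 from the positive
    and negative parts of h. The constant is uniform in h, as needed along a sequence. *)
Lemma functional_le_integral (D : set X) (sigma : 'I_n -> X -> R) :
  metric_bounded D -> (forall i, loc_lip (sigma i)) ->
  exists2 C : R, 0 <= C & forall (x0 : X) (h : X -> R), test_fun h -> spt h `<=` D ->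
    (`|T h sigma|%:E <= C%:E *
      \int[mass_measure T : set (borel_space X x0) -> \bar R]_x `|h x|%:E)%E.
Proof.
move=> Db sl; have [N [oN Nb DN']] := metric_bounded_nbhd Db.
have DN : D `<=` N by move=> x Dx; apply: DN' Dx _; rewrite mdistxx.
have [L L1 sL] : exists2 L, 1 <= L & forall i, lipschitz_in L N (sigma i : X -> R^o).
  have /choice[L /all_and2[L1 sL]] i : exists L, 1 <= L /\ lipschitz_in L N (sigma i : X -> R^o).
    by have [L] := lipschitz_on_bounded_ge1 (sl i) Nb; exists L.
  have L0 i : 0 <= L i by have := L1 i; lra.
  exists (1 + \sum_i L i); first by rewrite lerDl sumr_ge0.
  move=> i; apply: lipschitz_in_sub (sL i) => //.
  rewrite (bigD1 i)//= addrCA lerDl addr_ge0// sumr_ge0//.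
have [|q [q1 Tq]] := functional_lipschitz1 Tmf oN _ sl sL; first by lra.
have ql i : loc_lip (q i) by apply: lipschitz_map_on_bounded; exists 1; exact: q1.
have L0 : 0 <= L ^+ n by rewrite exprn_ge0//; lra.
exists (L ^+ n * 32) => [|x0 h th hD]; first by rewrite mulr_ge0.
have [TN _] := Tfin.2 N oN Nb.
rewrite Tq//; last exact: subset_trans DN.
rewrite normrM (ger0_norm L0) !EFinM -muleA lee_wpmul2l ?lee_fin//.
set I := (\int[_]_x _)%E.
have hl := test_fun_loc_lip th.
(* The positive part for s = 1, the negative part for s = -1. *)
have part (s : R) : `|s| = 1 -> test_fun (fun x => Num.max (s * h x) 0) /\
    (`|T (fun x => Num.max (s * h x)%R 0%R) q|%:E <= 16%:E * I)%E.
  move=> s1.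
  have le_h x : `|Num.max (s * h x) 0| <= `|h x|.
    rewrite -[leRHS]mul1r -s1 -normrM; case: (leP (s * h x) 0) => // _.
    by rewrite normr0.
  have tm : test_fun (fun x => Num.max (s * h x) 0).
    apply: test_fun_le th _ le_h.
    apply: (loc_lip_compR (K := 1) (theta := fun t => Num.max (s * t) 0)) => // a b.
    rewrite mul1r; have -> : `|a - b| = `|s * a - s * b|.
      by rewrite -mulrBr normrM s1 mul1r.
    move: (s * a) (s * b) => u v.
    case: (leP u 0) => u0; case: (leP v 0) => v0.
    - by rewrite subrr normr0.
    - by rewrite !ltr0_norm; lra.
    - by rewrite !gtr0_norm; lra.
    - by [].
  split => //; apply: (@le_trans _ _ (16%:E *
      \int[mass_measure T : set (borel_space X x0) -> \bar R]_x
        (Num.max (s * h x) 0)%:E)%E).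
    apply: (functional_le_integral_ge0 Tmf x0 TN) => //.
      by move=> x; rewrite le_max lexx orbT.
    apply: (subset_trans _ DN); apply: (subset_trans _ hD); apply: spt_le => x.
    by apply: contra => /eqP ->; rewrite mulr0 maxxx.
  rewrite lee_wpmul2l ?lee_fin//; apply: le_bare_integral => [|x|x].
  - exact: mass_measure_set0.
  - by rewrite lee_fin le_max lexx orbT.
  - rewrite lee_fin; apply: le_trans (le_h x); exact: ler_norm.
have [t1 T1] := part 1 (normr1 _); have [t2 T2] := part (-1) (normrN1 _).
have -> : T h q = T (fun x => Num.max (1 * h x) 0) q - T (fun x => Num.max (-1 * h x) 0) q.
  have t3 : test_fun (fun x => -1 * Num.max (-1 * h x) 0).
    have := test_fun_lin (-1) t2 (test_fun0 X).
    by under eq_fun do rewrite addr0.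
  have := functionalZ Tmf (-1) t2 ql; rewrite mulN1r => <-.
  rewrite -functionalD//; congr T; apply/funext => x; rewrite mul1r !mulN1r.
  by case: (leP (h x) 0) => h0; case: (leP (- h x) 0) => h1; lra.
apply: (@le_trans _ _ (16%:E * I + 16%:E * I)%E).
  apply: le_trans (leeD T1 T2); rewrite -EFinD lee_fin; exact: ler_normB.
rewrite (_ : 32%:E = 16%:E + 16%:E :> \bar R)%E; last by rewrite -EFinD; congr EFin; lra.
rewrite ge0_muleDl//.
Qed.

(** The set to which [borel_ext] applies [get]. Two extensions agree once these sets are equal, so
    identities are proved as pairs of inclusions. *)
Definition borel_ext_values (T : functional X n) (g : X -> R)
    (pi : 'I_n -> X -> R) : set R :=
  [set v : R | exists f : nat -> X -> R,
    [/\ forall k, test_fun (f k),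
        exists2 B : set X, metric_bounded B & forall k, spt (f k) `<=` B,
        forall x0 : X,
          (\int[mass_measure T : set (borel_space X x0) -> \bar R]_x
            `|f k x - g x|%:E)%E @[k --> \oo] --> 0%E &
        T (f k) pi @[k --> \oo] --> v]].

(* An approximating sequence [f k] of [g] may be replaced by [f k * chi], since
   [f k * (1 - chi)] tends to 0 in mean. *)
Lemma borel_ext_values_eq_on (A N : set X) (chi g : X -> R) (sigma tau : 'I_n -> X -> R) :
  test_fun chi -> (forall x, 0 <= chi x <= 1) -> (forall x, A x -> chi x = 1) ->
  open N -> spt chi `<=` N -> (forall x, ~ A x -> g x = 0) ->
  (forall i, loc_lip (sigma i)) -> (forall i, loc_lip (tau i)) ->
  (forall i x, N x -> sigma i x = tau i x) ->
  borel_ext_values T g sigma `<=` borel_ext_values T g tau.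
Proof.
move=> tchi chi01 chiA oN chiN gA sl tl st v [f [tf [B Bb fB] fg fv]].
have chil := test_fun_loc_lip tchi.
have chi'l : loc_lip (fun x => 1 - chi x) by apply: loc_lipB => //; exact: loc_lip_cst.
have tfc k : test_fun (fun x => f k x * chi x) by exact: test_funM.
have tfc' k : test_fun (fun x => f k x * (1 - chi x)) by exact: test_funM.
exists (fun k x => f k x * chi x); split => //.
- by exists B => // k; exact: subset_trans (@spt_mul _ _ _ _) (fB k).
- move=> x0; apply: (squeeze_cvge _ (cvg_cst _) (fg x0)).
  apply: nearW => k; apply/andP; split.
    by apply: bare_integral_ge0 => [||x]; [exact: mass_measure_set0|exact: mass_measure_ge0|rewrite lee_fin].
  apply: le_bare_integral => [|x|x]; first exact: mass_measure_set0.
    by rewrite lee_fin.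
  rewrite lee_fin; have [/chiA ->|/gA ->] := pselect (A x); first by rewrite mulr1.
  rewrite !subr0 normrM ler_piMr//; have /andP[c0 c1] := chi01 x.
  by rewrite ger0_norm.
(* On the support of f k * chi the two tuples agree, so tau may be replaced by sigma; what remains
   is to show that the (1 - chi) part tends to 0. *)
- have -> : (fun k => T (fun x => f k x * chi x) tau) =
      (fun k => T (f k) sigma - T (fun x => f k x * (1 - chi x)) sigma).
    apply/funext => k; rewrite -(functional_eq_on Tmf (p := sigma) (U := N))//.
      have := functionalD Tmf (tfc k) (tfc' k) sl.
      under eq_fun do rewrite -mulrDr subrKC mulr1.
      by move=> ->; rewrite addrK.
    by move=> x /= /sub_spt /(@spt_mulr _ _ _ _) /chiN.
  rewrite -[v in _ --> v]subr0; apply: cvgB => //.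
  (* The integrals require a base point; on the empty space every function is 0 and so is its
     value. *)
  have [[x0 _]|nX] := pselect (exists x0 : X, True); last first.
    rewrite (_ : (fun _ => _) = (fun=> 0)); first exact: cvg_cst.
    apply/funext => k; rewrite -[RHS](functional0 Tmf sl); congr T.
    by apply/funext => x; case: nX; exists x.
  have [C C0 TC] := functional_le_integral Bb sl.
  (* Pointwise |f k * (1 - chi)| <= |f k - g|: on A the left side is 0, off A the function g is
     0. *)
  have key k : (`|T (fun x => f k x * (1 - chi x))%R sigma|%:E <= C%:E *
      \int[mass_measure T : set (borel_space X x0) -> \bar R]_x `|f k x - g x|%:E)%E.
    apply: le_trans (TC x0 _ (tfc' k) _) _.
      exact: subset_trans (@spt_mul _ _ _ _) (fB k).
    rewrite lee_wpmul2l ?lee_fin//; apply: le_bare_integral => [|x|x].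
    - exact: mass_measure_set0.
    - by rewrite lee_fin.
    - rewrite lee_fin; have [/chiA ->|/gA ->] := pselect (A x).
        by rewrite subrr mulr0 normr0.
      rewrite subr0 normrM ler_piMr//; have /andP[c0 c1] := chi01 x.
      by rewrite ger0_norm; lra.
  apply/norm_cvg0P.
  suff : `|T (fun x => f k x * (1 - chi x)) sigma|%:E @[k --> \oo] --> 0%:E.
    by move=> /fine_cvgP[].
  apply: (@squeeze_cvge _ _ _ _ (cst 0%E) _ (fun k => C%:E * \int[mass_measure T : set (borel_space X x0) -> \bar R]_x `|f k x - g x|%:E)%E).
  + by apply: nearW => k; rewrite lee_fin normr_ge0 key.
  + exact: cvg_cst.
  + by rewrite -[X in _ --> X](mule0 C%:E); apply: cvgeZl => //; exact: fg.
Qed.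

Lemma borel_ext_eq_on (A N : set X) (chi g : X -> R) (sigma tau : 'I_n -> X -> R) :
  test_fun chi -> (forall x, 0 <= chi x <= 1) -> (forall x, A x -> chi x = 1) ->
  open N -> spt chi `<=` N -> (forall x, ~ A x -> g x = 0) ->
  (forall i, loc_lip (sigma i)) -> (forall i, loc_lip (tau i)) ->
  (forall i x, N x -> sigma i x = tau i x) ->
  borel_ext T g sigma = borel_ext T g tau.
Proof.
move=> tchi chi01 chiA oN chiN gA sl tl st; congr (get _); apply/seteqP; split.
  exact: (borel_ext_values_eq_on tchi chi01 chiA oN chiN gA).
by apply: (borel_ext_values_eq_on tchi chi01 chiA oN chiN gA) => // i x Nx; rewrite st.
Qed.

End BorelExt.

Section BorelExtPush.
Variables (R : realType) (X Y : metricType R) (psi : X -> Y) (phi : Y -> X).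
Hypotheses (psiK : cancel psi phi) (phiK : cancel phi psi).
Hypotheses (psi_lip : lipschitz_on_bounded psi) (phi_lip : lipschitz_on_bounded phi).
Variables (n : nat) (T : functional X n).
Hypothesis Tmf : metric_functional T.

(** Composition with psi turns an approximating sequence of g into one of g o psi. All differences f
    k - g vanish off the bounded set A [|] B, so a single comparison constant gives the convergence
    in mean. *)
Lemma borel_ext_values_push (A : set Y) (g : Y -> R) (sigma : 'I_n -> Y -> R) :
  metric_bounded A -> (forall y, ~ A y -> g y = 0) ->
  borel_ext_values (push_current psi T) g sigma `<=`
  borel_ext_values T (g \o psi) (fun i => sigma i \o psi).
Proof.
move=> Ab gA v [f [tf [B Bb fB] fg fv]]; exists (fun k => f k \o psi); split => //.
- by move=> k; exact: test_fun_comp psiK psi_lip phi_lip _ (tf k).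
- exists (psi @^-1` B); first exact: lipschitz_on_bounded_preimage psiK phi_lip Bb.
  by move=> k x /(spt_comp psi_lip) /fB.
move=> x0; have Smf := push_metric_functional psiK psi_lip phi_lip Tmf.
have [C C0 TS] := mass_measure_preimage_le psiK phiK psi_lip phi_lip Tmf
  (metric_boundedU Ab Bb).
have phi_cont := lipschitz_on_bounded_continuous phi_lip.
apply: (@squeeze_cvge _ _ _ _ (cst 0%E) _ (fun k => C%:E * \int[mass_measure (push_current psi T) :
  set (borel_space Y (psi x0)) -> \bar R]_y `|f k y - g y|%:E)%E).
- apply: nearW => k; apply/andP; split.
    by apply: bare_integral_ge0 => [||x]; [exact: mass_measure_set0|exact: mass_measure_ge0|rewrite lee_fin].
  apply: (@bare_integral_comp_le _ (borel_space X x0) _ (borel_space Y (psi x0)) R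
    (mass_measure T) (mass_measure (push_current psi T)) _ _ _ psi phi psiK phiK _
    C (A `|` B) (fun y => `|f k y - g y|%:E)) => //.
  + exact: mass_measure_set0.
  + exact: mass_measure_set0.
  + exact: mass_measure_ge0.
  + exact: borel_measurable_fun.
  + move=> y /not_orP[/gA -> yB]; rewrite subr0.
    have [->|/sub_spt/fB//] := eqVneq (f k y) 0; by rewrite normr0.
- exact: cvg_cst.
- by rewrite -[X in _ --> X](mule0 C%:E); apply: cvgeZl => //; exact: fg.
Qed.

End BorelExtPush.

(** * Restrictions to Borel sets and integer multiplicities *)

Section EuclidExtension.
Variables (R : realType) (n : nat).

Lemma euclid_coord_le (u v : euclid R n) j :
  `|(u : 'rV[R]_n) ord0 j - (v : 'rV[R]_n) ord0 j| <= mdist u v.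
Proof.
rewrite -sqrtr_sqr /mdist /= /euclid_dist ler_sqrt; last first.
  by apply: sumr_ge0 => i _; exact: sqr_ge0.
by rewrite (bigD1 j)//= lerDl sumr_ge0// => i _; exact: sqr_ge0.
Qed.

Lemma euclid_dist_le_coord (u v : euclid R n) (c : R) : 0 <= c ->
  (forall j, `|(u : 'rV[R]_n) ord0 j - (v : 'rV[R]_n) ord0 j| <= c) ->
  mdist u v <= Num.sqrt n%:R * c.
Proof.
move=> c0 uv; rewrite /mdist /= /euclid_dist -[X in _ * X]ger0_norm// -sqrtr_sqr.
rewrite -sqrtrM ?ler0n// ler_sqrt ?mulr_ge0 ?sqr_ge0//.
rewrite (_ : n%:R * c ^+ 2 = \sum_(j < n) c ^+ 2); last first.
  by rewrite sumr_const card_ord mulr_natl.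
apply: ler_sum => j _; rewrite -[leLHS]real_normK ?num_real//.
by rewrite lerXn2r ?nnegrE.
Qed.

(** McShane's extension in each coordinate; passing back to the Euclidean distance costs a factor
    sqrt n, which is harmless here. *)
Lemma euclid_lipschitz_extension (Z : metricType R) (A : set Z) (L : R)
    (p : Z -> euclid R n) : 0 <= L -> lipschitz_in L A p ->
  exists q : Z -> euclid R n, lipschitz_map q /\ forall x, A x -> q x = p x.
Proof.
move=> L0 pL.
have /choice[q /all_and2[qL qp]] j : exists q : Z -> R,
    lipschitz_in L setT (q : Z -> R^o) /\
    forall x, A x -> q x = (p x : 'rV[R]_n) ord0 j.
  have [|q [qL qp]] := @mcshane_extension _ Z A L (fun x => (p x : 'rV[R]_n) ord0 j) L0.
    apply: lipschitz_inRP => x y Ax Ay.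
    by apply: le_trans (pL x y Ax Ay); exact: euclid_coord_le.
  by exists q.
exists (fun x => (\row_j q j x)%R); split.
  exists (Num.sqrt n%:R * L) => x y _ _; rewrite -mulrA.
  apply: euclid_dist_le_coord; first by rewrite mulr_ge0 ?mdist_ge0.
  by move=> j; rewrite !mxE; exact: (lipschitz_inR (qL j) (x := x) (y := y) I I).
by move=> x Ax; apply/rowP => j; rewrite mxE qp.
Qed.

End EuclidExtension.

Section RestrPush.
Variables (R : realType) (X Y : metricType R) (psi : X -> Y) (phi : Y -> X).
Hypotheses (psiK : cancel psi phi) (phiK : cancel phi psi).
Hypotheses (psi_lip : lipschitz_on_bounded psi) (phi_lip : lipschitz_on_bounded phi).
Variables (n : nat) (T : functional X n).
Hypothesis Tfin : locally_finite_mass T.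

Lemma borel_ext_push (A : set Y) (g : Y -> R) (sigma : 'I_n -> Y -> R) :
  metric_bounded A -> (forall y, ~ A y -> g y = 0) ->
  borel_ext (push_current psi T) g sigma =
  borel_ext T (g \o psi) (fun i => sigma i \o psi).
Proof.
have [Tmf _] := Tfin; move=> Ab gA; congr (get _); apply/seteqP; split.
  exact: (borel_ext_values_push psiK phiK psi_lip phi_lip Tmf Ab gA).
have Smf := push_metric_functional psiK psi_lip phi_lip Tmf.
(* The reverse inclusion is the same lemma for phi and psi_# T, since pushing back by phi returns
   T. *)
have := @borel_ext_values_push _ _ _ phi psi phiK psiK phi_lip psi_lip _ _ Smf
  (psi @^-1` A) (g \o psi) (fun i => sigma i \o psi).
rewrite push_currentK// (_ : (g \o psi) \o phi = g); last first.
  by apply/funext => y /=; rewrite phiK.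
rewrite (_ : (fun i => (sigma i \o psi) \o phi) = sigma); last first.
  by apply/funext => i; apply/funext => y /=; rewrite phiK.
apply; last by move=> x; exact: gA.
exact: lipschitz_on_bounded_preimage psiK phi_lip Ab.
Qed.

Lemma restr_push_current_of :
  (forall (B : set X) (pi : X -> euclid R n),
    borel_set B -> metric_bounded B -> lipschitz_map pi ->
    exists2 theta : euclid R n -> int, L1int theta &
      forall f tau, test_fun f -> (forall i, loc_lip (tau i)) ->
        push_current pi (restr T B) f tau = current_of theta f tau) ->
  forall (B : set Y) (pi : Y -> euclid R n),
    borel_set B -> metric_bounded B -> lipschitz_map pi ->
    exists2 theta : euclid R n -> int, L1int theta &
      forall f tau, test_fun f -> (forall i, loc_lip (tau i)) ->
        push_current pi (restr (push_current psi T) B) f tau = current_of theta f tau.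
Proof.
move=> Trect B pi bB Bb pi_lip.
have B'b := lipschitz_on_bounded_preimage psiK phi_lip Bb.
have [chi [N [tchi chi01 chiB [oN Nb] chiN]]] := bounded_cutoff B'b.
have pil := lipschitz_map_on_bounded pi_lip.
have [L L1 piL] := lipschitz_on_bounded_ge1 (lipschitz_on_bounded_comp psi_lip pil) Nb.
(* q agrees with pi o psi on N, which contains psi^-1 B and the support of chi. Hence q may replace
   pi o psi both in the integrand, which carries the indicator of psi^-1 B, and in the
   coordinates. *)
have [|q [q_lip qpi]] := euclid_lipschitz_extension _ piL; first by lra.
have [|theta itheta Ttheta] := Trect (psi @^-1` B) q _ B'b q_lip.
  by apply: borel_set_preimage => //; exact: lipschitz_on_bounded_continuous.
exists theta => // f tau tf taul; rewrite -Ttheta// /push_current /restr.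
rewrite (borel_ext_push _ Bb); last by move=> y yB; rewrite indicE memNset// mulr0.
have -> : (fun y => (f \o pi) y * \1_B y) \o psi =
          (fun x => (f \o q) x * \1_(psi @^-1` B) x).
  apply/funext => x /=; have [Bx|nBx] := pselect (B (psi x)).
    rewrite qpi //; apply: chiN; apply: sub_spt.
    by rewrite (chiB x Bx) oner_eq0.
  by rewrite !indicE !memNset// !mulr0.
apply: (borel_ext_eq_on Tfin tchi chi01 chiB oN chiN).
- by move=> x xB; rewrite indicE memNset// mulr0.
- by move=> i; apply: loc_lip_comp => //; exact: loc_lip_comp.
- by move=> i; apply: loc_lip_comp => //; exact: lipschitz_map_on_bounded.
- by move=> i x Nx /=; rewrite qpi.
Qed.

End RestrPush.

(** * Hausdorff null sets and rectifiability *)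

Section HausdorffNull.
Variable R : realType.
Local Open Scope ereal_scope.

Lemma lebn_ge0 m (A : set 'rV[R]_m) : 0 <= lebn A.
Proof.
elim: m A => [|m IH] A /=; first by rewrite lee_fin.
by apply: integral_ge0 => x _; exact: IH.
Qed.

Lemma omega_ge0 m : (0 <= omega R m)%R.
Proof. by apply: fine_ge0; exact: lebn_ge0. Qed.

Lemma diam_ge0 (X : metricType R) (A : set X) : A !=set0 -> 0 <= diam A.
Proof.
move=> [a Aa]; apply: le_ereal_sup_tmp; exists (mdist a a)%:E; last by rewrite mdistxx.
by exists (a, a).
Qed.

Lemma hausdorff_weight_ge0 (X : metricType R) m (A : set X) :
  0 <= hausdorff_weight m A.
Proof.
rewrite /hausdorff_weight; case: eqP => // /eqP/set0P A0.
by rewrite mule_ge0// ?lee_fin ?divr_ge0 ?omega_ge0 ?exprn_ge0// expe_ge0// diam_ge0.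
Qed.

Lemma hausdorff_pre_ge0 (X : metricType R) m (delta : R) (A : set X) :
  0 <= hausdorff_pre m delta A.
Proof.
apply: le_ereal_inf_tmp => _ [C _ <-]; apply: nneseries_ge0 => k _ _.
exact: hausdorff_weight_ge0.
Qed.

Section Image.
Variables (X Y : metricType R) (psi : X -> Y).

Lemma diam_image_le (A B : set X) (L : R) : (0 <= L)%R -> lipschitz_in L A psi ->
  A `<=` B -> B !=set0 -> diam (psi @` A) <= L%:E * diam B.
Proof.
move=> L0 psiL AB B0; apply: ge_ereal_sup => _ [[_ _] /= [[x Ax <-] [y Ay <-]] <-].
apply: (@le_trans _ _ (L%:E * (mdist x y)%:E)); first by rewrite -EFinM lee_fin psiL.
rewrite lee_wpmul2l ?lee_fin//; apply: ereal_sup_ubound.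
by exists (x, y) => //; split; exact: AB.
Qed.

Lemma expe_le_mul m (L : R) (x y : \bar R) : (0 <= L)%R -> 0 <= x -> 0 <= y ->
  x <= L%:E * y -> x ^+ m <= (L ^+ m)%:E * y ^+ m.
Proof.
move=> L0 x0 y0 xy; elim: m => [|m IH]; first by rewrite !expr0 expe0 mule1.
rewrite !expeS exprS EFinM muleACA.
by apply: lee_pmul => //; exact: expe_ge0.
Qed.

Lemma hausdorff_weight_image_le m (A B : set X) (L : R) : (0 <= L)%R ->
  lipschitz_in L A psi -> A `<=` B ->
  hausdorff_weight m (psi @` A) <= (L ^+ m)%:E * hausdorff_weight m B.
Proof.
move=> L0 psiL AB; rewrite {1}/hausdorff_weight; case: eqP => [_|/eqP/set0P psiA0].
  by rewrite mule_ge0 ?hausdorff_weight_ge0// lee_fin exprn_ge0.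
have B0 : B !=set0 by move: psiA0 => [_ [x /AB Bx _]]; exists x.
rewrite /hausdorff_weight ifF; last by apply/negbTE/set0P.
rewrite muleCA lee_wpmul2l ?lee_fin ?divr_ge0 ?omega_ge0 ?exprn_ge0//.
by apply: expe_le_mul => //; [exact: diam_ge0|exact: diam_ge0|exact: diam_image_le].
Qed.

End Image.

Lemma bounded_exhaustion (X : metricType R) : exists B : nat -> set X,
  (forall k, metric_bounded (B k)) /\ forall x, exists k, B k x.
Proof.
have [[x0 _]|nX] := pselect (exists x0 : X, True).
  exists (fun k => [set x | (mdist x0 x < k%:R)%R]); split.
    by move=> k; exact: metric_bounded_mdist_lt.
  by move=> x; exists (Num.truncn (mdist x0 x)).+1 => /=; rewrite truncnS_gt.
exists (fun=> set0); split => [k|x]; first by exists 0%R.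
by case: nX; exists x.
Qed.

Lemma nat2_bij : exists h : nat -> nat * nat, set_bij setT setT h.
Proof.
by have /card_esym/ppcard_eqP[f] := card_nat2; exists f; exact: bij.
Qed.

(** Each bounded piece B k gets its own cover C k of N, of diameters at most delta / L k and total
    weight at most e / 2 ^ (k + 1) / L k ^ m. The images of C k j [&] B k, over all pairs (k, j),
    cover N' within delta and with total weight at most e. *)
Lemma hausdorff_null_image (X Y : metricType R) (psi : X -> Y) m (N : set X)
    (N' : set Y) : lipschitz_on_bounded psi -> hausdorff_measure m N = 0 ->
  N' `<=` psi @` N -> hausdorff_measure m N' = 0.
Proof.
move=> psi_lip HN N'N.
have preN (delta : R) : (0 < delta)%R -> hausdorff_pre m delta N = 0.
  move=> d0; apply/eqP; rewrite eq_le hausdorff_pre_ge0 andbT -HN.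
  by apply: ereal_sup_ubound; exists delta.
suff preN' (delta : R) : (0 < delta)%R -> hausdorff_pre m delta N' <= 0.
  apply/eqP; rewrite eq_le; apply/andP; split.
    by apply: ge_ereal_sup => _ [delta d0 <-]; exact: preN'.
  apply: le_ereal_sup_tmp; exists (hausdorff_pre m 1 N'); last exact: hausdorff_pre_ge0.
  by exists 1%R; first exact: ltr01.
move=> d0; apply/lee_addgt0Pr => e e0; rewrite add0e.
have [B [Bb Bcov]] := bounded_exhaustion X.
have /choice[L /all_and2[L1 psiL]] k : exists L : R, (1 <= L)%R /\ lipschitz_in L (B k) psi.
  by have [L] := lipschitz_on_bounded_ge1 psi_lip (Bb k); exists L.
have Lgt0 k : (0 < L k)%R by have := L1 k; lra.
have Ln k : (0 < L k ^+ m)%R by rewrite exprn_gt0.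
have /choice[C /all_and3[NC Cd Cw]] k : exists C : nat -> set X,
    [/\ N `<=` \bigcup_j C j, forall j, diam (C j) <= (delta / L k)%:E &
        \sum_(0 <= j <oo) hausdorff_weight m (C j) <= (e / (2 ^ k.+1)%:R / L k ^+ m)%:E].
  have : hausdorff_pre m (delta / L k) N < (e / (2 ^ k.+1)%:R / L k ^+ m)%:E.
    by rewrite preN ?divr_gt0// lte_fin !divr_gt0// ltr0n expn_gt0.
  by move=> /ereal_inf_lt[_ [C [NC Cd] <-] /ltW Cw]; exists C.
have [h hbij] := nat2_bij.
pose D (p : nat * nat) := psi @` (C p.1 p.2 `&` B p.1).
have Dw k j : hausdorff_weight m (D (k, j)) <= (L k ^+ m)%:E * hausdorff_weight m (C k j).
  apply: hausdorff_weight_image_le; first exact: ltW.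
    by apply: lipschitz_in_sub (psiL k) => // x [].
  by move=> x [].
apply: (@le_trans _ _ (\sum_(0 <= i <oo) hausdorff_weight m (D (h i)))).
  apply: ereal_inf_lbound; exists (D \o h) => //; split.
    move=> _ /N'N[x Nx <-]; have [k Bx] := Bcov x; have [j _ Cx] := NC k x Nx.
    have [_ _ /(_ (k, j) I)[i _ hi]] := hbij.
    by exists i => //=; rewrite hi; exists x.
  move=> i /=; case: (h i) => k j /=.
  have [C0|C0] := pselect (C k j !=set0); last first.
    rewrite /D /=; have -> : C k j = set0 by apply/eqP/negPn/negP => /set0P.
    rewrite set0I image_set0; apply: ge_ereal_sup => _ [p [[]]].
  apply: (@le_trans _ _ ((L k)%:E * diam (C k j))).
    apply: diam_image_le => //; first exact: ltW.
    by apply: lipschitz_in_sub (psiL k) => // x [].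
  by rewrite muleC -lee_pdivlMr.
have w0 p : 0 <= hausdorff_weight m (D p) by exact: hausdorff_weight_ge0.
(* The weights are nonnegative, so the series along the enumeration h of pairs is an iterated
   sum. *)
rewrite nneseries_esumT// -(reindex_esum setT setT h (fun p => hausdorff_weight m (D p)))//.
have -> : [set: nat * nat] = [set: nat] `*`` (fun=> [set: nat]).
  by apply/seteqP; split.
rewrite (eq_esum (b := fun k => hausdorff_weight m (D (k.1, k.2)))); last by move=> [].
rewrite -(esum_esum (a := fun k j => hausdorff_weight m (D (k, j))))//.
rewrite -nneseries_esumT; last by move=> k; exact: esum_ge0.
apply: le_trans (epsilon_trick0 xpredT (ltW e0)).
apply: lee_nneseries => [k _ _|k _]; first exact: esum_ge0.
rewrite -nneseries_esumT//.
apply: (@le_trans _ _ ((L k ^+ m)%:E * \sum_(0 <= j <oo) hausdorff_weight m (C k j))).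
  rewrite -nneseriesZl; last by move=> j _; exact: hausdorff_weight_ge0.
  by apply: lee_nneseries => // j _; exact: Dw.
by rewrite muleC -lee_pdivlMr// -EFinM.
Qed.

(** A chart p k may have unbounded image, where psi has no Lipschitz constant; it is split into its
    parts with values in the bounded sets B l, indexed by pairs (k, l). The uncovered points lie in
    the image of the uncovered null set. *)
Lemma countably_rectifiable_image (X Y : metricType R) (psi : X -> Y)
    (phi : Y -> X) m (E : set X) : cancel psi phi -> cancel phi psi ->
  lipschitz_on_bounded psi -> countably_rectifiable m E ->
  countably_rectifiable m (phi @^-1` E).
Proof.
move=> psiK phiK psi_lip [A [p [pL Enull]]].
have [B [Bb Bcov]] := bounded_exhaustion X.
have [h [_ _ hsurj]] := nat2_bij.
pose A' i := [set u : euclid R m | exists a : A (h i).1, val a = u /\ B (h i).2 (p _ a)].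
(* Charts are maps on subtypes; q sends a point of the smaller domain to the same point of the
   original one. *)
pose q i (u : A' i) : A (h i).1 := sval (cid (set_mem (valP u))).
have qE i u : val (@q i u) = val u by rewrite /q; case: cid => /= ? [].
have qB i u : B (h i).2 (p _ (@q i u)) by rewrite /q; case: cid => /= ? [].
exists A', (fun i u => psi (p _ (@q i u))); split.
  move=> i; have [L AL] := pL (h i).1.
  have [K K1 psiK'] := lipschitz_on_bounded_ge1 psi_lip (Bb (h i).2).
  exists (K * L)%R => u v; apply: le_trans (psiK' _ _ (qB i u) (qB i v)) _.
  rewrite -mulrA ler_wpM2l//; first by lra.
  by apply: le_trans (AL _ _) _; rewrite !qE.
apply: hausdorff_null_image psi_lip Enull _ => y [/= Ey ny].
exists (phi y); last exact: phiK.
split => // -[k _ [a _ pa]]; apply: ny; have [l Bl] := Bcov (phi y).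
have [i _ hi] := hsurj (k, l) I; exists i => //.
have A'a : val a \in A' i.
  apply/mem_set; rewrite /A' /=; move: (hi) => -> /=.
  by exists a; rewrite pa.
exists (SigSub A'a) => //; rewrite -[RHS]phiK; congr psi.
move: (q i _) (qE i (SigSub A'a)) => b; rewrite /=.
move: b; rewrite hi /= => b /val_inj ->; exact: pa.
Qed.

End HausdorffNull.

(** * Lower density and completions *)

Section Density.
Variables (R : realType) (X Y : metricType R) (psi : X -> Y) (phi : Y -> X).
Hypotheses (psiK : cancel psi phi) (phiK : cancel phi psi).
Hypotheses (psi_lip : lipschitz_on_bounded psi) (phi_lip : lipschitz_on_bounded phi).
Variables (n : nat) (T : functional X n).
Hypothesis Tmf : metric_functional T.
Local Open Scope ereal_scope.

(** For small r, psi maps the ball of radius r / L about p into the ball of radius r about psi p.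
    Comparing masses costs a factor C and rescaling the radius costs L ^ n, so the lower density
    stays above c / (C * L ^ n). *)
Lemma set_d_push (p : X) : set_d T p -> set_d (push_current psi T) (psi p).
Proof.
rewrite /set_d /= !limf_einfE => /ereal_sup_gt[_ [V V0 <-]]; set c := ereal_inf _ => c0.
have [d /= d0 dV] : exists2 d : R, (0 < d)%R & forall r, (0 < r < d)%R -> V r.
  have /nbhs_ballP[d /= d0 dV] := V0; exists d => // r /andP[r0 rd].
  by apply: dV => //; rewrite /ball /= sub0r normrN gtr0_norm.
have [L L1 psiL] := lipschitz_on_bounded_ge1 psi_lip (@metric_bounded_mdist_lt _ _ p 1).
have L0 : (0 < L)%R by lra.
have [C C0 TS] := mass_measure_preimage_le psiK phiK psi_lip phi_lip Tmf
  (@metric_bounded_mdist_lt _ _ (psi p) 1).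
have CL : (0 < C * L ^+ n)%R by rewrite mulr_gt0 ?exprn_gt0.
(* The bound 1 keeps the balls where L and C are valid; the bound d puts r / L, which is at most r,
   among the radii controlled by c. *)
pose W := [set r : R | (0 < r < Num.min 1 d)%R].
set F := fun r : R => mass_measure (push_current psi T) _ * _.
have cF r : W r -> c <= (C * L ^+ n)%:E * F r.
  rewrite /W /= lt_min => /and3P[r0 r1 rd].
  have rL0 : (0 < r / L)%R by rewrite divr_gt0.
  have rLr : (r / L <= r)%R by rewrite ler_pdivrMr// ler_peMr// ltW.
  apply: (@le_trans _ _ (mass_measure T (ball p (r / L)) *
      ((omega R n * (r / L) ^+ n)^-1)%:E)).
    apply: ereal_inf_lbound; exists (r / L)%R => //; apply: dV.
    by rewrite rL0 (le_lt_trans rLr).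
  have -> : ((omega R n * (r / L) ^+ n)^-1 = L ^+ n * (omega R n * r ^+ n)^-1)%R.
    by rewrite expr_div_n mulrA invfM invrK mulrC.
  rewrite EFinM muleCA /F (mulrC C) EFinM -muleA [X in _ <= _ * X]muleA.
  rewrite lee_wpmul2l ?lee_fin ?exprn_ge0 ?(ltW L0)//.
  rewrite lee_wpmul2r ?lee_fin ?invr_ge0 ?mulr_ge0 ?omega_ge0 ?exprn_ge0 ?(ltW r0)//.
  apply: le_trans (TS _ _); last by move=> y; rewrite ballEmdist /=; lra.
  apply: mass_measure_sub => x; rewrite !ballEmdist /= => px.
  apply: (@le_lt_trans _ _ (L * mdist p x)%R); last by rewrite mulrC -ltr_pdivlMr.
  by apply: psiL => /=; rewrite ?mdistxx; lra.
have cpos : 0 < ((C * L ^+ n)^-1)%:E * c by rewrite mule_gt0// lte_fin invr_gt0.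
apply: (lt_le_trans cpos); apply: le_ereal_sup_tmp; exists (ereal_inf (F @` W)).
  exists W => //; apply/nbhs_ballP; exists (Num.min 1 d)%R => /=.
    by rewrite lt_min ltr01.
  move=> r; rewrite /ball /= sub0r normrN => rd r0; rewrite /W /= r0 /=.
  by move: rd; rewrite gtr0_norm.
apply: le_ereal_inf_tmp => _ [r Wr <-].
by rewrite lee_pdivrMl//; exact: cF.
Qed.

End Density.

(** * Extension of the map to the completions *)

Section CompletionExtension.
Variable R : realType.

Lemma embed_near (X : metricType R) (Xb : completion X) (x : Xb) (e : R) :
  0 < e -> exists z : X, mdist x (embed Xb z) < e.
Proof.
move=> e0; have [||w [xw [z _ zw]]] := @embed_dense R X Xb [set y | mdist x y < e].
- by exists x => /=; rewrite mdistxx.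
- apply/open_mdistP => y /= yr; exists (e - mdist x y); first by rewrite subr_gt0.
  by move=> w yw; have := metric_triangle x y w; lra.
- by exists z; rewrite zw.
Qed.

Lemma metric_bounded_embed (X : metricType R) (Xb : completion X) (B : set Xb) :
  metric_bounded B -> metric_bounded (embed Xb @^-1` B).
Proof. by move=> [M BM]; exists M => x y /= Bx By; rewrite -(@embed_isometry _ _ Xb) BM. Qed.

Lemma eq_on_completion (X Z : metricType R) (Xb : completion X) (f g : Xb -> Z) :
  lipschitz_on_bounded f -> lipschitz_on_bounded g ->
  (forall x, f (embed Xb x) = g (embed Xb x)) -> f = g.
Proof.
move=> fl gl fg; apply/funext => x; apply: mdist_positivity; apply/eqP.
rewrite eq_le mdist_ge0 andbT; apply/ler_addgt0Pr => e e0; rewrite add0r.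
have bx := @metric_bounded_mdist_lt _ _ x 1.
have [L L1 fL] := lipschitz_on_bounded_ge1 fl bx.
have [K K1 gK] := lipschitz_on_bounded_ge1 gl bx.
have LK : 0 < L + K by lra.
have [|z] := @embed_near _ Xb x (Num.min 1 (e / (L + K))).
  by rewrite lt_min ltr01 divr_gt0.
rewrite lt_min ltr_pdivlMr// => /andP[z1 ze].
have xx : [set y | mdist x y < 1] x by rewrite /= mdistxx.
have := fL _ _ xx z1; have := gK _ _ xx z1; rewrite fg.
have := metric_triangle (f x) (g (embed Xb z)) (g x).
rewrite (metric_sym (g (embed Xb z)) (g x)); lra.
Qed.

Variables (X Y : metricType R) (Xb : completion X) (Yb : completion Y) (psi : X -> Y).
Hypothesis psi_lip : lipschitz_on_bounded psi.

(** The images under psi of the points of X near x generate a filter, which is Cauchy because psi is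
    Lipschitz on the trace of the unit ball about x; y is its limit. *)
Lemma completion_extension_at (x : Xb) : exists y : Yb, forall e : R, 0 < e ->
  exists2 d : R, 0 < d & forall z : X, mdist x (embed Xb z) < d ->
    mdist y (embed Yb (psi z)) < e.
Proof.
pose F : set_system Yb := [set A | exists2 d : R, 0 < d &
  forall z : X, mdist x (embed Xb z) < d -> A (embed Yb (psi z))].
have FF : ProperFilter F.
  split.
    by move=> [d d0 dF]; have [z /dF] := embed_near x d0.
  split.
  - by exists 1.
  - move=> A B [d d0 dA] [e e0 eB]; exists (Num.min d e); first by rewrite lt_min d0.
    by move=> z; rewrite lt_min => /andP[/dA ? /eB].
  - by move=> A B AB [d d0 dA]; exists d => // z /dA /AB.
have [L L1 psiL] := lipschitz_on_bounded_ge1 psi_lip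
  (@metric_bounded_embed _ Xb _ (@metric_bounded_mdist_lt _ _ x 1)).
have L0 : 0 < L by lra.
have cF : cauchy F.
  apply/cauchy_ballP => e e0; pose d := Num.min 1 (e / (2 * L)).
  have d0 : 0 < d by rewrite lt_min ltr01 divr_gt0// mulr_gt0.
  pose A := [set embed Yb (psi z) | z in [set z | mdist x (embed Xb z) < d]].
  have FA : F A by exists d => // z xz; exists z.
  exists (A, A) => // -[_ _] [/= [z xz <-] [w xw <-]].
  move: xz xw => /=; rewrite /d !lt_min !ltr_pdivlMr ?mulr_gt0// => /andP[z1 ze] /andP[w1 we].
  rewrite ballEmdist /= embed_isometry.
  have := psiL z w z1 w1; rewrite -(@embed_isometry _ _ Xb z w).
  have : L * mdist (embed Xb z) (embed Xb w) <=
      L * (mdist x (embed Xb z) + mdist x (embed Xb w)).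
    rewrite ler_wpM2l ?(ltW L0)// (metric_sym x (embed Xb z)); exact: metric_triangle.
  by rewrite mulrDr; lra.
have [y Fy] := completion_complete FF cF.
exists y => e e0; have [d d0 dy] := Fy _ (nbhsx_ballx y e e0).
by exists d => // z /dy; rewrite ballEmdist.
Qed.

Lemma completion_extension : exists psib : Xb -> Yb, lipschitz_on_bounded psib /\
  forall x, psib (embed Xb x) = embed Yb (psi x).
Proof.
have [psib psibP] := choice completion_extension_at; exists psib; split.
  move=> B /metric_bounded_nbhd[N [_ Nb BN]].
  have [L L1 psiL] := lipschitz_on_bounded_ge1 psi_lip (metric_bounded_embed Nb).
  exists L => x x' Bx Bx'; apply/ler_addgt0Pr => e e0.
  (* Two approximations within k in the source cost 2 * L * k, two in the target cost 2 * k;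
     together e. *)
  pose k := e / (2 + 2 * L).
  have k0 : 0 < k by rewrite divr_gt0//; lra.
  have ke : k * (2 + 2 * L) = e by rewrite divfK// gt_eqF//; lra.
  have close y : B y -> exists z, [/\ N (embed Xb z), mdist y (embed Xb z) < k &
      mdist (psib y) (embed Yb (psi z)) < k].
    move=> By; have [d d0 dy] := psibP y k k0.
    have [|z] := @embed_near _ Xb y (Num.min 1 (Num.min k d)).
      by rewrite !lt_min ltr01 k0.
    rewrite !lt_min => /and3P[z1 zk zd]; exists z; split => //; last exact: dy.
    exact: BN By z1.
  have [z [Nz xz xz']] := close x Bx; have [w [Nw xw xw']] := close x' Bx'.
  have := psiL z w Nz Nw; rewrite -(@embed_isometry _ _ Xb z w) -(@embed_isometry _ _ Yb (psi z)).
  have := metric_triangle (psib x) (embed Yb (psi z)) (psib x').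
  have := metric_triangle (embed Yb (psi z)) (embed Yb (psi w)) (psib x').
  rewrite (metric_sym (embed Yb (psi w))).
  have : L * mdist (embed Xb z) (embed Xb w) <= L * (mdist x x' + k + k).
    rewrite ler_wpM2l//; first by lra.
    have := metric_triangle (embed Xb z) x (embed Xb w).
    have := metric_triangle x x' (embed Xb w).
    by rewrite (metric_sym (embed Xb z) x); lra.
  by rewrite !mulrDr; lra.
move=> x; apply: mdist_positivity; apply/eqP; rewrite eq_le mdist_ge0 andbT.
apply/ler_addgt0Pr => e e0; rewrite add0r.
by have [d d0 dx] := psibP (embed Xb x) e e0; apply/ltW/dx; rewrite mdistxx.
Qed.

End CompletionExtension.

Lemma completion_bijection (R : realType) (X Y : metricType R) (Xb : completion X)
    (Yb : completion Y) (psi : X -> Y) : bilipschitz_on_bounded psi ->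
  exists (psib : Xb -> Yb) (phib : Yb -> Xb),
    [/\ cancel psib phib /\ cancel phib psib, lipschitz_on_bounded psib,
        lipschitz_on_bounded phib, forall x, psib (embed Xb x) = embed Yb (psi x) &
        psib @` range (@embed R X Xb) = range (@embed R Y Yb)].
Proof.
move=> [psi_lip [phi [psiK phiK phi_lip]]].
have [psib [psibl psibE]] := completion_extension Xb Yb psi_lip.
have [phib [phibl phibE]] := completion_extension Yb Xb phi_lip.
have idl (Z : metricType R) : lipschitz_on_bounded (@id Z).
  by move=> B _; exists 1 => x y _ _; rewrite mul1r.
exists psib, phib; split => //.
- split => x.
    have := @eq_on_completion _ X Xb Xb (phib \o psib) id
      (lipschitz_on_bounded_comp psibl phibl) (@idl _).
    by move=> /(_ (fun z => _))/(congr1 (fun f => f x)); apply => z /=;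
      rewrite psibE phibE psiK.
  have := @eq_on_completion _ Y Yb Yb (psib \o phib) id
    (lipschitz_on_bounded_comp phibl psibl) (@idl _).
  by move=> /(_ (fun z => _))/(congr1 (fun f => f x)); apply => z /=;
    rewrite phibE psibE phiK.
- apply/seteqP; split => [_ [_ [x _ <-] <-]|_ [y _ <-]].
    by rewrite psibE; exists (psi x).
  by exists (embed Xb (phi y)); [exists (phi y)|rewrite psibE phiK].
Qed.

Lemma locally_integral_push (R : realType) (X Y : metricType R) (psi : X -> Y)
    (phi : Y -> X) n (T : functional X n) :
  cancel psi phi -> cancel phi psi -> lipschitz_on_bounded psi ->
  lipschitz_on_bounded phi -> locally_integral T ->
  locally_integral (push_current psi T).
Proof.
move=> psiK phiK psi_lip phi_lip [[Tfin [E [bE rE TE]] TN Trect] Tbd].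
have Tmf := Tfin.1; have phi_cont := lipschitz_on_bounded_continuous phi_lip.
split; last exact: (boundary_push psiK psi_lip phi_lip Tbd).
split.
- exact: (locally_finite_mass_push psiK psi_lip phi_lip Tmf Tfin).
- exists (phi @^-1` E); split.
  + exact: borel_set_preimage.
  + exact: countably_rectifiable_image psiK phiK psi_lip rE.
  + exact: (null_push psiK psi_lip phi_lip Tmf TE).
(* psi^-1 N is the image of N under phi, hence Hausdorff null and so null for T; [null_push] brings
   this back to N. *)
- move=> N bN HN; rewrite (_ : N = phi @^-1` (psi @^-1` N)); last first.
    by apply/seteqP; split => y /=; rewrite phiK.
  apply: (null_push psiK psi_lip phi_lip Tmf); apply: TN.
    by apply: borel_set_preimage => //; exact: lipschitz_on_bounded_continuous.
  by apply: hausdorff_null_image phi_lip HN _ => x Nx; exists (psi x).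
- exact: (restr_push_current_of psiK phiK psi_lip phi_lip Tfin Trect).
Qed.

(** Continuity and compatibility with the embeddings determine [psib], as X is dense in its
    completion; the existential therefore denotes the extension of psi. *)
Theorem theorem2p18 (R : realType) (n : nat) (X Y : metricType R)
    (Xb : completion X) (Yb : completion Y) (T : functional Xb n) (psi : X -> Y) :
  local_integral_current_space T ->
  bilipschitz_on_bounded psi ->
  exists psib : Xb -> Yb,
    [/\ continuous psib,
        forall x, psib (embed Xb x) = embed Yb (psi x),
        pushable psib &
        local_integral_current_space (push_current psib T)].
Proof.
move=> [Tint Tset] /(completion_bijection Xb Yb).
move=> [psib [phib [[psiK phiK] psi_lip phi_lip psibE psib_range]]].
exists psib; split => //; first exact: lipschitz_on_bounded_continuous.
  split => // B; exact: lipschitz_on_bounded_preimage.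
have Tmf : metric_functional T by case: Tint => -[[]].
have Smf := push_metric_functional psiK psi_lip phi_lip Tmf.
split; first exact: locally_integral_push psiK phiK psi_lip phi_lip Tint.
rewrite -psib_range -Tset; apply/seteqP; split => [y Sy|_ [x Tx <-]].
  exists (phib y); last exact: phiK.
  (* Density is transported back by phib, whose push-forward of psib_# T is T. *)
  have := set_d_push phiK psiK phi_lip psi_lip Smf Sy.
  by rewrite push_currentK.
exact: (set_d_push psiK phiK psi_lip phi_lip Tmf Tx).
Qed.
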